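(* Assume the setting of the context. Let $v=(v_1,v_2)$ be the unique bounded constrained viscosity solution on $[\underline{x},+\infty)$ of $$\rho v_j(x)=H(x,y_j,Dv_j(x))+\lambda_j\big(v_{\bar\jmath}(x)-v_j(x)\big),\qquad j=1,2.$$ For $\Delta=(h,\Delta x)$ let $\mathbf{V}=(V_{\cdot,1},V_{\cdot,2})$ be the unique bounded solution of the scheme $\mathcal{F}^\Delta_j(x_i,(V_{i,j},V_{i,\bar\jmath}),V_{\cdot,j})=0$ ($i\in\mathbb{N}$, $j=1,2$), and let $v^\Delta_j(x)=\sum_{k\in\mathbb{N}}V_{k,j}\beta_k(x)$. Then, as $\Delta\to0$ with $\Delta x\sim h$, $v^\Delta\to v$ locally uniformly on $[\underline{x},+\infty)$.
   Context: Constants: $\rho>0$, $r<\rho$, $0<y_1<y_2$, $\gamma>1$, $\underline{x}\le0$ with $\rho\underline{x}+y_j>0$, $\lambda_1,\lambda_2\ge0$; $\bar\jmath=3-j$; $u(c)=\frac{c^{1-\gamma}}{1-\gamma}$ for $c>0$, $u(0)=-\infty$; $H(x,y_j,p)=\sup_{c\ge0}\{u(c)+(rx+y_j-c)p\}$, equal to $(rx+y_j)p+\frac{\gamma}{1-\gamma}p^{1-1/\gamma}$ for $p\ge0$ and $+\infty$ for $p<0$. Viscosity subsolution on $S\subseteq[\underline{x},\infty)$: u.s.c. pair $v$ such that whenever $\varphi$ smooth, $j\in\{1,2\}$, and $v_j-\varphi$ has a local max (relative to $[\underline{x},\infty)$) at $x_0\in S$, then $\rho v_j(x_0)\le H(x_0,y_j,D\varphi(x_0))+\lambda_j(v_{\bar\jmath}(x_0)-v_j(x_0))$;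 supersolution: l.s.c. pair with reverse inequality at local minima. Constrained viscosity solution: continuous, supersolution on $(\underline{x},\infty)$, subsolution on $[\underline{x},\infty)$. Discretization $\Delta=(h,\Delta x)$, $h,\Delta x>0$, $\rho h<1$, $\lambda_jh<1$; ''$\Delta x\sim h$'' means $h/\Delta x$ stays between two fixed positive constants. Grid $x_i=\underline{x}+i\Delta x$, $i\in\mathbb{N}=\{0,1,\dots\}$. $\beta_k(x)=\max\{0,1-|x-x_k|/\Delta x\}$ for $x\ge\underline{x}$. $\mathcal{C}^\Delta_j(x_i)=\{c\ge0:x_i+h(rx_i+y_j-c)\ge\underline{x}\}$, $s_{i,j}(c)=rx_i+y_j-c$. Scheme: $$\mathcal{F}^\Delta_j(x_i,(\mathsf{q}_j,\mathsf{q}_{\bar\jmath}),\mathsf{U})=\rho\mathsf{q}_j-(1-\rho h)\lambda_j(\mathsf{q}_{\bar\jmath}-\mathsf{q}_j)-\sup_{c\in\mathcal{C}^\Delta_j(x_i)}\Big\{u(c)+\frac{(1-\rho h)(1-\lambda_jh)}{h}\Big(\sum_k\beta_k(x_i+hs_{i,j}(c))\mathsf{U}_k-\mathsf{q}_j\Big)\Big\}.$$ *)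

(* Defs.v *)
From HB Require Import structures.
From mathcomp Require Import all_boot all_order all_algebra.
From mathcomp Require Import all_classical all_reals all_analysis.
Set Implicit Arguments. Unset Strict Implicit. Unset Printing Implicit Defensive.
Import Order.TTheory GRing.Theory Num.Theory.
Import numFieldNormedType.Exports.
Local Open Scope ring_scope.
Local Open Scope classical_set_scope.

Inductive idx := J1 | J2.
Definition other (j : idx) : idx := match j with J1 => J2 | J2 => J1 end.

Record model (R : realType) := Model {
  rho : R; r : R; y1 : R; y2 : R; gam : R; xl : R; lam1 : R; lam2 : R }.

Definition admissible (R : realType) (m : model R) : Prop :=
  0 < rho m /\ r m < rho m /\ 0 < y1 m /\ y1 m < y2 m /\
  1 < gam m /\ xl m <= 0 /\
  0 < rho m * xl m + y1 m /\ 0 < rho m * xl m + y2 m /\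
  0 <= lam1 m /\ 0 <= lam2 m.

Definition yj (R : realType) (m : model R) (j : idx) : R :=
  match j with J1 => y1 m | J2 => y2 m end.
Definition lamj (R : realType) (m : model R) (j : idx) : R :=
  match j with J1 => lam1 m | J2 => lam2 m end.

(* CRRA utility, u(0) = -oo (and -oo for c <= 0; only c >= 0 is ever used). *)
Definition util (R : realType) (m : model R) (c : R) : \bar R :=
  if 0 < c then ((c `^ (1 - gam m)) / (1 - gam m))%:E else -oo%E.

Definition Ham (R : realType) (m : model R) (x y p : R) : \bar R :=
  ereal_sup [set (util m c + ((r m * x + y - c) * p)%:E)%E | c in [set c : R | 0 <= c]].

Definition smooth (R : realType) (phi : R -> R) : Prop :=
  forall (n : nat) (x : R), derivable (derive1n n phi) x 1.

Definition loc_max_rel (R : realType) (m : model R) (f : R -> R) (x0 : R) : Prop :=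
  exists2 e : R, 0 < e & forall x, xl m <= x -> `|x - x0| < e -> f x <= f x0.
Definition loc_min_rel (R : realType) (m : model R) (f : R -> R) (x0 : R) : Prop :=
  exists2 e : R, 0 < e & forall x, xl m <= x -> `|x - x0| < e -> f x0 <= f x.

Definition viscosity_subsol (R : realType) (m : model R) (v : idx -> R -> R)
    (S : set R) : Prop :=
  forall (phi : R -> R) (j : idx) (x0 : R), smooth phi -> S x0 ->
    loc_max_rel m (fun x => v j x - phi x) x0 ->
    ((rho m * v j x0)%:E <=
       Ham m x0 (yj m j) (derive1 phi x0) + (lamj m j * (v (other j) x0 - v j x0))%:E)%E.

Definition viscosity_supersol (R : realType) (m : model R) (v : idx -> R -> R)
    (S : set R) : Prop :=
  forall (phi : R -> R) (j : idx) (x0 : R), smooth phi -> S x0 ->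
    loc_min_rel m (fun x => v j x - phi x) x0 ->
    ((rho m * v j x0)%:E >=
       Ham m x0 (yj m j) (derive1 phi x0) + (lamj m j * (v (other j) x0 - v j x0))%:E)%E.

Definition constrained_sol (R : realType) (m : model R) (v : idx -> R -> R) : Prop :=
  [/\ forall j, {within `[xl m, +oo[%classic, continuous (v j)},
      viscosity_supersol m v `]xl m, +oo[%classic &
      viscosity_subsol m v `[xl m, +oo[%classic ].

Definition bounded_sol (R : realType) (m : model R) (v : idx -> R -> R) : Prop :=
  exists K : R, forall j x, xl m <= x -> `|v j x| <= K.

Definition grid (R : realType) (m : model R) (dx : R) (i : nat) : R := xl m + i%:R * dx.
Definition beta (R : realType) (m : model R) (dx : R) (k : nat) (x : R) : R :=
  Num.max 0 (1 - `|x - grid m dx k| / dx).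
Definition interp (R : realType) (m : model R) (dx : R) (U : nat -> R) (x : R) : R :=
  limn (fun n : nat => \sum_(0 <= k < n) (beta m dx k x * U k)) (* = sum_{k in N} beta_k(x) U_k *).

Definition drift (R : realType) (m : model R) (dx : R) (j : idx) (i : nat) (c : R) : R :=
  r m * grid m dx i + yj m j - c.
Definition Cset (R : realType) (m : model R) (h dx : R) (j : idx) (i : nat) : set R :=
  [set c : R | 0 <= c /\ xl m <= grid m dx i + h * drift m dx j i c].

(* Scheme: F^Delta_j(x_i, (V_{i,j}, V_{i,jbar}), V_{.,j}) = 0, written in \bar R as
   sup{...} = rho V_{i,j} - (1 - rho h) lam_j (V_{i,jbar} - V_{i,j}). *)
Definition scheme_sol (R : realType) (m : model R) (h dx : R) (V : idx -> nat -> R) : Prop :=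
  forall (j : idx) (i : nat),
    ereal_sup [set (util m c +
        ((1 - rho m * h) * (1 - lamj m j * h) / h *
          (interp m dx (V j) (grid m dx i + h * drift m dx j i c) - V j i))%:E)%E
       | c in Cset m h dx j i]
    = (rho m * V j i - (1 - rho m * h) * lamj m j * (V (other j) i - V j i))%:E.

Definition bounded_grid (R : realType) (V : idx -> nat -> R) : Prop :=
  exists K : R, forall j i, `|V j i| <= K.

(* Main.v *)
(** The scheme and the viscosity solution are compared directly by doubling of
variables, with the penalty [pen k t = k/2 * max(0,t)^2], which is flat to the
left. Since [r < rho], the affine function [gshift + x] is a supersolution, so
by convexity of the Hamiltonian a supersolution may be replaced by its convex
combination (weight [d]) with this function: this localizes the maximum and
forces the slope of the penalty to be bounded below by a multiple of [d], which
in turn bounds the (near-)optimal consumption, hence the consistency error,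
uniformly as [h -> 0]. The state constraint is handled by shifting the penalty
by [sg], so that the point at which the supersolution is used stays off the
boundary. For the upper bound on the scheme this follows from the continuity of
[v]; for the lower bound it follows from the scheme itself, where an inward
drift is available near the boundary and bounds the slope. *)

Require Import Defs.
From HB Require Import structures.
From mathcomp Require Import all_boot all_order all_algebra.
From mathcomp Require Import all_classical all_reals all_analysis.
From mathcomp Require Import ring lra.
Set Implicit Arguments.
Unset Strict Implicit.
Unset Printing Implicit Defensive.
Import Order.TTheory GRing.Theory Num.Theory.
Import numFieldNormedType.Exports.
Local Open Scope ring_scope.
Local Open Scope classical_set_scope.

(** * Polynomial test functions, uniform continuity and existence of maxima *)

Lemma derive1n_horner (R : realType) (p : {poly R}) (n : nat) :
  derive1n n (horner p) = horner p^`(n).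
Proof. by elim: n => [//|n IH]; rewrite derive1nS IH derivnS derivE. Qed.

Lemma smooth_horner (R : realType) (p : {poly R}) : smooth (horner p).
Proof. by move=> n x; rewrite derive1n_horner; exact: derivable_horner. Qed.

(** Heine-Cantor with only [x] confined to the segment, since the comparison point [z] may leave it.
    Compactness is used in its near-covering form, with the radius as parameter tending to [0] from
    the right. *)
Lemma unif_continuous_segment (R : realType) (f : R -> R) (a b e : R) :
  continuous f -> 0 < e ->
  exists2 d, 0 < d & forall x z, a <= x <= b -> `|z - x| <= d -> `|f z - f x| <= e.
Proof.
move=> cf e0.
have := (compact_near_coveringP `[a, b]).1 (@segment_compact R a b) R 0^'+
  (fun d x => forall z, `|z - x| <= d -> `|f z - f x| <= e).
case=> [x _|d /= d0 H].
  have e20 : 0 < e / 2 by lra.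
  have /cvgrPdist_lt /(_ _ e20) := cf x.
  move=> /nbhs_ballP[w /= w0 Hw].
  exists (ball x (w / 2), [set d | 0 < d < w / 2]) => /=.
    split; first by apply: nbhsx_ballx; lra.
    by near=> d => /=; apply/andP; split; near: d;
      [exact: nbhs_right_gt|apply: nbhs_right_lt; lra].
  move=> [x' d] /= [bx /andP[d0 dw]] z zx'.
  have h1 : `|f x - f x'| < e / 2 by apply: Hw; apply: le_ball bx; lra.
  have h2 : `|f x - f z| < e / 2.
    apply: Hw; rewrite /ball /=.
    move: bx; rewrite /ball /= => bx.
    rewrite (le_lt_trans (ler_distD x' _ _))//.
    by rewrite (distrC x' z); lra.
  rewrite (le_trans (ler_distD (f x) _ _))// (distrC (f z)); lra.
exists (d / 2); first lra.
move=> x z xab; apply: H => /=.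
- by rewrite /ball /= sub0r normrN gtr0_norm; lra.
- lra.
- by rewrite in_itv.
Unshelve. all: by end_near. Qed.

Lemma continuous_clamp (R : realType) (f : R -> R) (a : R) :
  {within `[a, +oo[, continuous f} -> continuous (fun x => f (Num.max a x)).
Proof.
move=> /subspace_continuousP cf x.
have am y : a <= Num.max a y by rewrite le_max lexx.
apply: (@cvg_comp _ _ _ (Num.max a) f _ (within `[a, +oo[ (nbhs (Num.max a x)))); last first.
  by apply: cf; rewrite /= in_itv /= andbT le_max lexx.
move=> A /= wA; rewrite nbhs_filterE.
have cmax : continuous (fun y : R => Num.max a y).
  by move=> y; apply: (@continuous_max _ _ (cst a) id); [exact: cvg_cst|exact: cvg_id].
have h : nbhs x [set y | `[a, +oo[ (Num.max a y) -> A (Num.max a y)].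
  exact: (cmax x _ wA).
by apply: filterS h => y /= h; apply: h; rewrite /= in_itv /= andbT am.
Qed.

Lemma max_on_box (R : realType) (f : idx -> nat -> R -> R) (a b : R) (N : nat) :
  (forall j i, continuous (f j i)) -> a <= b ->
  exists j i y, a <= y <= b /\
    forall j' i' y', (i' <= N)%N -> a <= y' <= b -> f j' i' y' <= f j i y.
Proof.
move=> cf ab.
have one j i : exists2 y, a <= y <= b & forall y', a <= y' <= b -> f j i y' <= f j i y.
  have [y] := EVT_max ab (continuous_subspaceT (cf j i)).
  by rewrite in_itv /= => yab H; exists y => // y' y'ab; apply: H; rewrite in_itv.
have two i : exists j y, a <= y <= b /\ forall j' y', a <= y' <= b -> f j' i y' <= f j i y.
  have [u ua Hu] := one J1 i; have [w wa Hw] := one J2 i.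
  have [le|/ltW le] := leP (f J1 i u) (f J2 i w).
    exists J2, w; split=> // -[] y' y'ab; last exact: Hw.
    exact: le_trans (Hu _ y'ab) le.
  exists J1, u; split=> // -[] y' y'ab; first exact: Hu.
  exact: le_trans (Hw _ y'ab) le.
elim: N => [|N [j [i [y [yab IH]]]]].
  have [j [y [yab H]]] := two 0; exists j, 0, y; split=> // j' i' y'.
  by rewrite leqn0 => /eqP ->; exact: H.
have [j1 [y1 [y1ab H]]] := two N.+1.
have [le|/ltW le] := leP (f j i y) (f j1 N.+1 y1).
  exists j1, N.+1, y1; split=> // j' i' y'; rewrite leq_eqVlt => /orP[/eqP ->|iN] y'ab.
    exact: H.
  exact: le_trans (IH _ _ _ iN y'ab) le.
exists j, i, y; split=> // j' i' y'; rewrite leq_eqVlt => /orP[/eqP ->|iN] y'ab.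
  exact: le_trans (H _ _ y'ab) le.
exact: IH.
Qed.

(** Coercivity: every point that beats the reference point [(J1, 0, a)] lies in a compact box, so
    the maximum over the box is global. *)
Lemma max_attained (R : realType) (f : idx -> nat -> R -> R) (a b : R) (N : nat) :
  (forall j i, continuous (f j i)) ->
  (forall j i y, a <= y -> f J1 0 a <= f j i y -> (i <= N)%N /\ y <= b) ->
  exists j i y, a <= y /\ forall j' i' y', a <= y' -> f j' i' y' <= f j i y.
Proof.
move=> cf H; have [_ ab] := H J1 0%N a (lexx _) (lexx _).
have [j [i [y [/andP[ay yb] M]]]] := @max_on_box R f a b N cf ab.
exists j, i, y; split=> // j' i' y' ay'.
have [le|/ltW le] := leP (f J1 0 a) (f j' i' y').
  have [iN yb'] := H _ _ _ ay' le.
  by apply: M => //; rewrite ay'.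
by apply: (le_trans le); apply: M; rewrite ?lexx.
Qed.

(** * Interpolation and the one-sided penalty *)

(** Only the hats of the two nodes around [z] can be nonzero there, so the partial sums are constant
    from index [n.+2] on and the limit is a convex combination of two values. The pair [n], [th]
    does not depend on [U]. *)
Lemma interpE (R : realType) (m : model R) (dx z : R) : 0 < dx -> xl m <= z ->
  exists n th, [/\ 0 <= th <= 1, z = grid m dx n + th * dx &
    forall U, interp m dx U z = (1 - th) * U n + th * U n.+1].
Proof.
move=> dx0 xz.
pose q := (z - xl m) / dx.
have q0 : 0 <= q by rewrite divr_ge0 ?subr_ge0 // ltW.
have zE : z = xl m + q * dx by rewrite /q divfK ?gt_eqF //; ring.
have := truncn_itv q0; set n := Num.truncn q => /andP[nq qn].
exists n, (q - n%:R); split.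
- by rewrite -natr1 in qn; lra.
- by rewrite zE /grid; ring.
move=> U; rewrite /interp.
have bE k : beta m dx k z = Num.max 0 (1 - `|q - k%:R|).
  rewrite /beta {1}zE /grid; congr (Num.max 0 (1 - _)).
  have -> : xl m + q * dx - (xl m + k%:R * dx) = (q - k%:R) * dx by ring.
  by rewrite normrM (gtr0_norm dx0) mulfK ?gt_eqF.
apply: lim_near_cst; first exact: norm_hausdorff.
exists n.+2 => // N /= nN.
rewrite (big_cat_nat (n := n)) //=; last exact: leq_trans (leq_trans (leqnSn _) (leqnSn _)) nN.
rewrite big1_seq ?add0r; last first.
  move=> k; rewrite mem_index_iota => /andP[_ /andP[_ kn]].
  have : k.+1%:R <= n%:R :> R by rewrite ler_nat.
  rewrite bE -natr1 => h.
  rewrite (max_idPl _) ?mul0r // ger0_norm; lra.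
rewrite (big_cat_nat (n := n.+2)) //=; last exact: leq_trans (leqnSn _) _.
rewrite [X in _ + X]big1_seq ?addr0; last first.
  move=> k; rewrite mem_index_iota => /andP[_ /andP[kn _]].
  have : n.+2%:R <= k%:R :> R by rewrite ler_nat.
  rewrite bE -[n.+2]addn2 natrD => h.
  rewrite -natr1 in qn.
  rewrite (max_idPl _) ?mul0r // ler0_norm; lra.
rewrite big_nat_recl // big_nat1 !bE.
move: qn; rewrite -natr1 => qn.
rewrite ger0_norm ?subr_ge0 // ler0_norm; last lra.
rewrite !(max_idPr _); [ring|lra|lra].
Qed.

Definition pen (R : realType) (k t : R) : R := k / 2 * Num.max 0 t ^+ 2.

Lemma pen_ge0 (R : realType) (k t : R) : 0 <= k -> 0 <= pen k t.
Proof. by move=> k0; rewrite /pen mulr_ge0 ?sqr_ge0 ?divr_ge0. Qed.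

Lemma pen_pos (R : realType) (k t : R) : 0 <= t -> pen k t = k / 2 * t ^+ 2.
Proof. by move=> t0; rewrite /pen (max_idPr t0). Qed.

Lemma pen_neg (R : realType) (k t : R) : t <= 0 -> pen k t = 0.
Proof. by move=> t0; rewrite /pen (max_idPl t0) expr0n mulr0. Qed.

Lemma pen_le_quad (R : realType) (k t : R) : 0 <= k -> pen k t <= k / 2 * t ^+ 2.
Proof.
move=> k0; have [t0|/ltW t0] := leP 0 t; first by rewrite pen_pos.
by rewrite pen_neg // mulr_ge0 ?sqr_ge0 ?divr_ge0.
Qed.

(** The derivative [k * Num.max 0 t] of the penalty is [k]-Lipschitz, which gives a Taylor upper
    bound without second differentiability at the kink. *)
Lemma pen_expand (R : realType) (k t d : R) : 0 <= k ->
  pen k (t + d) <= pen k t + k * Num.max 0 t * d + k / 2 * d ^+ 2.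
Proof.
move=> k0; have [t0|t0] := ltP t 0.
  rewrite (pen_neg k (ltW t0)) mulr0 mul0r !add0r.
  have [td|/ltW td] := leP (t + d) 0.
    by rewrite pen_neg // mulr_ge0 ?sqr_ge0 ?divr_ge0.
  by rewrite pen_pos // ler_wpM2l ?divr_ge0 // ler_pXn2r // ?nnegrE; lra.
rewrite (le_trans (pen_le_quad _ _)) // pen_pos // le_eqVlt.
by apply/orP; left; apply/eqP; field.
Qed.

(** The [min] separates jumps that stay on the quadratic side from those that land in the flat
    region, where nothing beyond [pen k t] can be lost. *)
Lemma pen_drop (R : realType) (k t d : R) : 0 <= k -> 0 <= t -> d <= 0 ->
  pen k (t + d) - pen k t <= - (k * t / 2 * Num.min (- d) t).
Proof.
move=> k0 t0 d0; rewrite (pen_pos k t0).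
have [td|td] := leP (- d) t.
  rewrite pen_pos; last lra.
  have : 0 <= k * (- d * (t + d)) by rewrite !mulr_ge0; lra.
  lra.
rewrite pen_neg; last lra.
lra.
Qed.

Lemma continuous_pen (R : realType) (k : R) (g : R -> R) :
  continuous g -> continuous (fun y => pen k (g y)).
Proof.
move=> cg.
have c2 : continuous (fun y : R => Num.max 0 (g y)).
  by move=> y; apply: (@continuous_max _ _ (cst 0) g); [exact: cvg_cst|exact: cg].
move=> y; rewrite /pen; apply: cvgM; first exact: cvg_cst.
by under eq_fun do rewrite expr2; rewrite expr2; apply: cvgM; exact: c2.
Qed.

(** A comparison with [psi] at the nodes passes to the interpolant: the first-order terms at the two
    neighbouring nodes cancel under the weights [1 - th] and [th], and only a quadratic error
    survives. The factor [a] may be negative, so that one statement serves both bounds. *)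
Lemma interp_touch (R : realType) (m : model R) (dx k a z : R) (V : nat -> R)
    (i : nat) (psi : R -> R) :
  0 < dx -> 0 <= k -> xl m <= z ->
  (forall x, exists p, forall d, psi (x + d) <= psi x + p * d + k / 2 * d ^+ 2) ->
  (forall n, a * (V n - V i) <= psi (grid m dx n) - psi (grid m dx i)) ->
  a * (interp m dx V z - V i) <= psi z - psi (grid m dx i) + k / 2 * dx ^+ 2.
Proof.
move=> dx0 k0 xz Hpsi HV.
have [n [th [/andP[th0 th1] zE ->]]] := @interpE R m dx z dx0 xz.
have [p Hp] := Hpsi z.
have e1 : grid m dx n = z + (- (th * dx)) by rewrite zE; ring.
have e2 : grid m dx n.+1 = z + (1 - th) * dx by rewrite zE /grid -natr1; ring.
have := Hp (- (th * dx)); rewrite -e1 => h1.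
have := Hp ((1 - th) * dx); rewrite -e2 => h2.
have := HV n; have := HV n.+1 => h3 h4.
have {h1 h4} h5 : (1 - th) * (a * (V n - V i)) <= (1 - th) *
    (psi z + p * (- (th * dx)) + k / 2 * (- (th * dx)) ^+ 2 - psi (grid m dx i)).
  by rewrite ler_wpM2l; lra.
have {h2 h3} h6 : th * (a * (V n.+1 - V i)) <= th *
    (psi z + p * ((1 - th) * dx) + k / 2 * ((1 - th) * dx) ^+ 2 - psi (grid m dx i)).
  by rewrite ler_wpM2l; lra.
have h7 : 0 <= k / 2 * dx ^+ 2 * (1 - th * (1 - th)).
  by apply: mulr_ge0; [rewrite mulr_ge0 ?sqr_ge0 ?divr_ge0|nra].
nra.
Qed.

(** * Utility, and viscosity inequalities tested with quadratics *)

Definition cu (R : realType) (m : model R) (c : R) : R :=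
  c `^ (1 - gam m) / (1 - gam m).

Lemma util_pos (R : realType) (m : model R) (c : R) : 0 < c -> util m c = (cu m c)%:E.
Proof. by rewrite /util => ->. Qed.

Lemma util_neg (R : realType) (m : model R) (c : R) : c <= 0 -> util m c = -oo%E.
Proof. by rewrite /util leNgt => /negbTE ->. Qed.

Lemma cu_le0 (R : realType) (m : model R) (c : R) : 1 < gam m -> cu m c <= 0.
Proof.
by move=> g1; rewrite /cu mulr_ge0_le0 ?powR_ge0 // invr_le0; lra.
Qed.

Lemma cu_ge (R : realType) (m : model R) (c : R) :
  1 < gam m -> 1 <= c -> (1 - gam m)^-1 <= cu m c.
Proof.
move=> g1 c1; rewrite /cu -[leLHS]mul1r ler_wnM2r //; first by rewrite invr_le0; lra.
by rewrite -[leRHS](powRr0 c) ler_powR //; lra.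
Qed.

Lemma quad_poly (R : realType) (al be : R) : exists p : {poly R},
  (forall x, p.[x] = al * x ^+ 2 + be * x) /\ (forall x, p^`().[x] = 2 * al * x + be).
Proof.
exists (al *: 'X^2 + be *: 'X); split=> x; first by rewrite !hornerE.
by rewrite !poly.derivE !hornerE /=; ring.
Qed.

(** Bounding the supremum in [Ham] from below by a single consumption gives a real inequality for
    every [c], free of extended reals. *)
Lemma supersol_quad (R : realType) (m : model R) (v : idx -> R -> R) (S : set R)
    (j : idx) (x0 al be c : R) :
  viscosity_supersol m v S -> S x0 ->
  loc_min_rel m (fun x => v j x - (al * x ^+ 2 + be * x)) x0 -> 0 < c ->
  cu m c + (r m * x0 + yj m j - c) * (2 * al * x0 + be)
    + lamj m j * (v (other j) x0 - v j x0) <= rho m * v j x0.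
Proof.
move=> Hv Sx H c0; have [p [pE dpE]] := quad_poly al be.
have := Hv (horner p) j x0 (@smooth_horner R p) Sx.
have -> : (fun x => v j x - p.[x]) = (fun x => v j x - (al * x ^+ 2 + be * x)).
  by apply/funext => x; rewrite pE.
move=> /(_ H); rewrite -derivE dpE -lee_fin => le; apply: le_trans le.
rewrite EFinD leeD2r // /Ham; apply: ereal_sup_ubound; exists c => /=; first exact: ltW.
by rewrite util_pos.
Qed.

(** The supremum in [Ham] may be unattained or infinite, so a consumption that is optimal up to [e]
    is extracted. It is positive because [util] is [-oo] elsewhere. *)
Lemma subsol_quad (R : realType) (m : model R) (v : idx -> R -> R) (S : set R)
    (j : idx) (x0 al be e : R) :
  viscosity_subsol m v S -> S x0 ->
  loc_max_rel m (fun x => v j x - (al * x ^+ 2 + be * x)) x0 -> 0 < e ->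
  exists2 c, 0 < c & rho m * v j x0 - e <=
    cu m c + (r m * x0 + yj m j - c) * (2 * al * x0 + be)
    + lamj m j * (v (other j) x0 - v j x0).
Proof.
move=> Hv Sx H e0; have [p [pE dpE]] := quad_poly al be.
have := Hv (horner p) j x0 (@smooth_horner R p) Sx.
have -> : (fun x => v j x - p.[x]) = (fun x => v j x - (al * x ^+ 2 + be * x)).
  by apply/funext => x; rewrite pE.
move=> /(_ H); rewrite -derivE dpE; set L := lamj _ _ * _ => le.
have : ((rho m * v j x0 - e - L)%:E < Ham m x0 (yj m j) (2 * al * x0 + be))%E.
  rewrite EFinB lteBlDr // (lt_le_trans _ le) // lte_fin; lra.
move=> /ereal_sup_gt[_ [c /= c0 <-]].
have [c1|c1] := ltP 0 c; last by rewrite util_neg //= ltNge leNye.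
rewrite util_pos // -EFinD lte_fin => h; exists c => //; lra.
Qed.

(** * The scheme as real inequalities, and its a priori bounds *)

(** The factor of the increment in the scheme, a perturbation of [1 / h]: [schemeK_bounds] puts
    [schemeK m h j * h] within O(h) below 1. *)
Definition schemeK (R : realType) (m : model R) (h : R) (j : idx) : R :=
  (1 - rho m * h) * (1 - lamj m j * h) / h.

Lemma scheme_ge (R : realType) (m : model R) (h dx : R) (V : idx -> nat -> R)
    (j : idx) (i : nat) (c : R) :
  scheme_sol m h dx V -> 0 < c -> xl m <= grid m dx i + h * drift m dx j i c ->
  cu m c + schemeK m h j * (interp m dx (V j) (grid m dx i + h * drift m dx j i c) - V j i)
  <= rho m * V j i - (1 - rho m * h) * lamj m j * (V (other j) i - V j i).
Proof.
move=> /(_ j i) HV c0 xz; rewrite -lee_fin -HV; apply: ereal_sup_ubound.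
by exists c => /=; [split=> //; exact: ltW|rewrite util_pos].
Qed.

Lemma scheme_le (R : realType) (m : model R) (h dx : R) (V : idx -> nat -> R)
    (j : idx) (i : nat) (e : R) :
  scheme_sol m h dx V -> 0 < e ->
  exists c, [/\ 0 < c, xl m <= grid m dx i + h * drift m dx j i c &
  rho m * V j i - (1 - rho m * h) * lamj m j * (V (other j) i - V j i) - e <=
  cu m c + schemeK m h j * (interp m dx (V j) (grid m dx i + h * drift m dx j i c) - V j i)].
Proof.
move=> /(_ j i) HV e0; set X := _ - (1 - _) * _ * _.
have : ((X - e)%:E < X%:E)%E by rewrite lte_fin; lra.
rewrite /X -HV => /ereal_sup_gt[_ [c /= [c0 xz] <-]].
have [c1|c1] := ltP 0 c; last by rewrite util_neg //= ltNge leNye.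
rewrite util_pos // -EFinD lte_fin => le; exists c; split=> //.
exact: ltW.
Qed.

Lemma schemeK_bounds (R : realType) (m : model R) (h : R) (j : idx) :
  admissible m -> 0 < h -> rho m * h < 1 -> lam1 m * h < 1 -> lam2 m * h < 1 ->
  [/\ 0 < schemeK m h j, schemeK m h j * h <= 1 &
      1 - (rho m + lam1 m + lam2 m) * h <= schemeK m h j * h].
Proof.
move=> [rho0 [_ [_ [_ [_ [_ [_ [_ [l1 l2]]]]]]]]] h0 rh l1h l2h.
have [lj0 ljh ljl] : [/\ 0 <= lamj m j, lamj m j * h < 1 & lamj m j <= lam1 m + lam2 m].
  by case: j; split=> //=; lra.
have e : schemeK m h j * h = (1 - rho m * h) * (1 - lamj m j * h).
  by rewrite /schemeK divfK ?gt_eqF.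
have a1 : 0 <= rho m * h by rewrite mulr_ge0; lra.
have a2 : 0 <= lamj m j * h by rewrite mulr_ge0; lra.
have a3 : lamj m j * h <= (lam1 m + lam2 m) * h by rewrite ler_wpM2r; lra.
split; rewrite ?e; [|nra|nra].
by rewrite /schemeK divr_gt0 // mulr_gt0; lra.
Qed.

Lemma lamj_bounds (R : realType) (m : model R) (j : idx) : admissible m ->
  0 <= lamj m j <= lam1 m + lam2 m.
Proof. by move=> [_ [_ [_ [_ [_ [_ [_ [_ [l1 l2]]]]]]]]]; case: j => /=; lra. Qed.

Lemma yj_bounds (R : realType) (m : model R) (j : idx) : admissible m ->
  y1 m <= yj m j <= y2 m.
Proof. by move=> [_ [_ [_ [y12 _]]]]; case: j => /=; lra. Qed.

Lemma interp_le (R : realType) (m : model R) (dx z S : R) (U : nat -> R) :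
  0 < dx -> xl m <= z -> (forall n, U n <= S) -> interp m dx U z <= S.
Proof.
move=> dx0 xz US; have [n [th [/andP[? ?] _ ->]]] := interpE dx0 xz.
by have := US n; have := US n.+1; nra.
Qed.

Lemma interp_ge (R : realType) (m : model R) (dx z S : R) (U : nat -> R) :
  0 < dx -> xl m <= z -> (forall n, S <= U n) -> S <= interp m dx U z.
Proof.
move=> dx0 xz US; have [n [th [/andP[? ?] _ ->]]] := interpE dx0 xz.
by have := US n; have := US n.+1; nra.
Qed.

Lemma grid_ge (R : realType) (m : model R) (dx : R) (i : nat) :
  0 < dx -> xl m <= grid m dx i.
Proof. by move=> dx0; rewrite /grid lerDl mulr_ge0 // ltW. Qed.

(** Discrete maximum principle: near the supremum [S] over both components, interpolation and
    coupling can raise the value by only a multiple of [tau], and utility is nonpositive, so [S > 0]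
    is impossible. The supremum over the infinite grid is only approached, hence the slack [tau]. *)
Lemma scheme_le0 (R : realType) (m : model R) (h dx : R) (V : idx -> nat -> R) :
  admissible m -> 0 < h -> 0 < dx ->
  rho m * h < 1 -> lam1 m * h < 1 -> lam2 m * h < 1 ->
  bounded_grid V -> scheme_sol m h dx V -> forall j i, V j i <= 0.
Proof.
move=> adm h0 dx0 rh l1h l2h [B HB] HV.
pose E := [set x | exists j i, x = V j i].
have hsE : has_sup E.
  split; first by exists (V J1 0%N); exists J1, 0%N.
  by exists B => _ [j [i ->]]; rewrite (le_trans (ler_norm _)).
pose S := sup E.
have VS j i : V j i <= S by apply: sup_upper_bound => //; exists j, i.
suff S0 : S <= 0 by move=> j i; exact: le_trans (VS j i) S0.
rewrite leNgt; apply/negP => S0.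
have [rho0 [_ [_ [_ [g1 _]]]]] := adm.
have := lamj_bounds J1 adm => /= /andP[l0 ll].
(* [D] collects the coefficients of all error terms in [tau]; the total error [tau * D] is then half
   of [rho m * S]. *)
pose D := rho m + (lam1 m + lam2 m) + h^-1 + 1.
have hi : 0 < h^-1 by rewrite invr_gt0.
have D0 : 0 < D by rewrite /D; lra.
pose tau := rho m * S / (2 * D).
have tau0 : 0 < tau by rewrite /tau divr_gt0 // mulr_gt0 //.
have tauE : tau * D = rho m * S / 2.
  by rewrite /tau; field; rewrite gt_eqF.
have [_ [j [i ->]]] := sup_adherent tau0 hsE.
rewrite -/S => Vt.
have [c [c0 xz le]] := @scheme_le R m h dx V j i (tau) HV tau0.
have := cu_le0 c g1.
have := interp_le dx0 xz (VS j).
have [K0 K1 _] := schemeK_bounds j adm h0 rh l1h l2h.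
have KH : schemeK m h j <= h^-1 by rewrite -[leRHS]mul1r ler_pdivlMr.
have /andP[lj0 ljl] := lamj_bounds j adm.
move: le; set I := interp _ _ _ _ => le IS cu0.
have h1 : schemeK m h j * (I - V j i) <= h^-1 * tau.
  apply: (le_trans (y := schemeK m h j * tau)); first by rewrite ler_wpM2l; lra.
  by rewrite ler_wpM2r; lra.
have rh0 : 0 < rho m * h by rewrite mulr_gt0.
have h2 : (1 - rho m * h) * lamj m j * (V (other j) i - V j i) <= (lam1 m + lam2 m) * tau.
  apply: (le_trans (y := (1 - rho m * h) * lamj m j * tau)).
    rewrite ler_wpM2l //; first by rewrite mulr_ge0 //; lra.
    by have := VS (other j) i; lra.
  rewrite ler_wpM2r //; first lra.
  rewrite (le_trans _ ljl) // ler_piMl //; lra.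
move: tauE; rewrite /D => tauE.
have : rho m * (S - tau) < rho m * V j i by rewrite ltr_pM2l; lra.
have : 0 < rho m * S by rewrite mulr_gt0.
lra.
Qed.

(** The constant consumption [rho m * xl m + y1 m] is admissible at every node, so the minimum
    principle bounds the solution below by its discounted utility, uniformly in [h] and [dx]. *)
Lemma scheme_lb (R : realType) (m : model R) (h dx : R) (V : idx -> nat -> R) :
  admissible m -> 0 < h -> 0 < dx ->
  rho m * h < 1 -> lam1 m * h < 1 -> lam2 m * h < 1 -> 0 <= 1 + h * r m ->
  bounded_grid V -> scheme_sol m h dx V ->
  forall j i, cu m (rho m * xl m + y1 m) / rho m <= V j i.
Proof.
move=> adm h0 dx0 rh l1h l2h hr [B HB] HV.
pose E := [set x | exists j i, x = V j i].
have hsE : has_inf E.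
  split; first by exists (V J1 0%N); exists J1, 0%N.
  exists (- B) => _ [j [i ->]].
  by have := HB j i; rewrite ler_norml => /andP[].
pose S := inf E.
have VS j i : S <= V j i by apply: ge_inf; [exact: hsE.2|exists j, i].
have [rho0 [rrho [_ [_ [g1 [xl0 [c00 _]]]]]]] := adm.
set c0 := rho m * xl m + y1 m.
suff S0 : cu m c0 / rho m <= S by move=> j i; exact: le_trans S0 (VS j i).
rewrite ler_pdivrMr // leNgt; apply/negP => S0.
have := lamj_bounds J1 adm => /= /andP[l0 ll].
pose D := rho m + (lam1 m + lam2 m) + h^-1 + 1.
have hi : 0 < h^-1 by rewrite invr_gt0.
have D0 : 0 < D by rewrite /D; lra.
pose tau := (cu m c0 - rho m * S) / (2 * D).
have tau0 : 0 < tau by rewrite /tau divr_gt0; lra.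
have tauE : tau * D = (cu m c0 - rho m * S) / 2.
  by rewrite /tau; field; rewrite gt_eqF.
have [_ [j [i ->]]] := inf_adherent tau0 hsE.
rewrite -/S => Vt.
have /andP[yj0 _] := yj_bounds j adm.
(* The distance of the next state from [xl m] is the sum of the three nonnegative terms below;
   [xl m <= 0] and [r m < rho m] enter through the last. *)
have xz : xl m <= grid m dx i + h * drift m dx j i c0.
  have g0 := grid_ge m i dx0.
  rewrite /drift /c0.
  have : 0 <= (1 + h * r m) * (grid m dx i - xl m) by rewrite mulr_ge0; lra.
  have : 0 <= h * (yj m j - y1 m) by rewrite mulr_ge0; lra.
  have : 0 <= h * ((rho m - r m) * (- xl m)) by rewrite !mulr_ge0; lra.
  lra.
have le := @scheme_ge R m h dx V j i c0 HV c00 xz.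
have := interp_ge dx0 xz (VS j).
have [K0 K1 _] := schemeK_bounds j adm h0 rh l1h l2h.
have KH : schemeK m h j <= h^-1 by rewrite -[leRHS]mul1r ler_pdivlMr.
have /andP[lj0 ljl] := lamj_bounds j adm.
move: le; set I := interp _ _ _ _ => le IS.
have h1 : - (h^-1 * tau) <= schemeK m h j * (I - V j i).
  apply: (le_trans (y := schemeK m h j * - tau)).
    by rewrite mulrN lerN2 ler_wpM2r; lra.
  by rewrite ler_wpM2l; lra.
have rh0 : 0 < rho m * h by rewrite mulr_gt0.
have h2 : - ((lam1 m + lam2 m) * tau) <= (1 - rho m * h) * lamj m j * (V (other j) i - V j i).
  apply: (le_trans (y := (1 - rho m * h) * lamj m j * - tau)).
    rewrite mulrN lerN2 ler_wpM2r //; first lra.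
    rewrite (le_trans _ ljl) // ler_piMl //; lra.
  rewrite ler_wpM2l //; first by rewrite mulr_ge0 //; lra.
  by have := VS (other j) i; lra.
move: tauE; rewrite /D => tauE.
have : rho m * V j i < rho m * (S + tau) by rewrite ltr_pM2l; lra.
lra.
Qed.

(** * The affine supersolution and consistency estimates *)

(** Chosen so that [rho m * (gshift m + x) - (r m * x + y2 m)] equals [(rho m - r m) * (x - xl m)],
    which is nonnegative on the domain. *)
Definition gshift (R : realType) (m : model R) : R :=
  (y2 m - (rho m - r m) * xl m) / rho m.

Lemma gshift_super (R : realType) (m : model R) (j : idx) (x c : R) :
  admissible m -> xl m <= x -> 0 < c ->
  cu m c + (r m * x + yj m j - c) <= rho m * (gshift m + x).
Proof.
move=> adm xx c0; have /andP[_ yy] := yj_bounds j adm.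
have [rho0 [rrho [_ [_ [g1 _]]]]] := adm.
have := cu_le0 c g1.
have -> : rho m * (gshift m + x) = y2 m - (rho m - r m) * xl m + rho m * x.
  by rewrite /gshift; field; rewrite gt_eqF.
have : 0 <= (rho m - r m) * (x - xl m) by rewrite mulr_ge0; lra.
lra.
Qed.

(** This reflects that [Ham] is infinite at negative slopes: utility stays bounded below for large
    [c], so [- c * q] would grow without bound if [q < 0]. *)
Lemma slope_ge0 (R : realType) (m : model R) (X Y Z q : R) : 1 < gam m ->
  (forall c, 0 < c -> cu m c + (X - c) * q + Y <= Z) -> 0 <= q.
Proof.
move=> g1 H; rewrite leNgt; apply/negP => q0.
pose W := Z - Y - (1 - gam m)^-1 - X * q.
have W0 : 0 < (`|W| + 1) / (- q) by rewrite divr_gt0 ?oppr_gt0 // ltr_wpDl.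
pose c := 1 + (`|W| + 1) / (- q).
have := H c; have := @cu_ge _ m c g1; rewrite /c => h1 h2.
have := h1 ltac:(lra); have := h2 ltac:(lra); rewrite -/c.
have cq : c * q = q - (`|W| + 1) by rewrite /c; field; rewrite lt_eqF.
have := ler_norm W; rewrite {1}/W; lra.
Qed.

(* Under the one-sided penalty a jump to the left of length [- h * s] costs at
   least a multiple of [min (- h * s) t], so only jumps of size O(h) can be
   near-optimal. *)
Lemma drift_lb (R : realType) (K h k t s d C : R) :
  0 < h -> 0 < k -> 0 < t -> 0 < d -> d <= k * t -> 0 < C ->
  1 / 2 <= K * h -> 4 * h * k * C < d ^+ 2 ->
  - C <= K * (pen k (t + h * s) - pen k t) -> d * - s <= 4 * C.
Proof.
move=> h0 k0 t0 d0 dkt C0 Kh small H.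
have K0 : 0 < K by rewrite -(pmulr_lgt0 _ h0); lra.
have [s0|s0] := leP 0 s.
  by apply: (le_trans (y := 0)); [rewrite mulrN oppr_le0 mulr_ge0 // ltW|lra].
have hs : h * s <= 0 by rewrite mulr_ge0_le0 // ltW.
have le1 := pen_drop (ltW k0) (ltW t0) hs.
have le2 : K * (k * t / 2 * Num.min (- (h * s)) t) <= C.
  rewrite -lerN2; apply: (le_trans H); rewrite -(mulrN K) ler_wpM2l //; exact: ltW.
have [le|lt] := leP (- (h * s)) t.
  move: le2; rewrite (min_idPl le) => le2.
  have : 1 / 2 * (d / 2 * - s) <= K * h * (k * t / 2 * - s).
    rewrite ler_pM //; try lra.
      by rewrite mulr_ge0; lra.
    by rewrite ler_wpM2r; lra.
  lra.
(* A jump longer than [t] would give [d ^+ 2 <= 4 * h * k * C], against the smallness of [h]. *)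
move: le2; rewrite (min_idPr (ltW lt)) => le2.
have : 1 / 2 * (d ^+ 2) <= K * h * (k * t) ^+ 2.
  rewrite ler_pM ?sqr_ge0 //; try lra.
  by rewrite ler_pXn2r // ?nnegrE; lra.
have -> : K * h * (k * t) ^+ 2 = 2 * h * k * (K * (k * t / 2 * t)) by field.
have : 2 * h * k * (K * (k * t / 2 * t)) <= 2 * h * k * C.
  by rewrite ler_wpM2l // !mulr_ge0; lra.
lra.
Qed.

(** Consistency of the difference quotient with the derivative term [s * (k * t)]: the first error
    comes from [K * h] differing from 1, the second from the curvature of the penalty. *)
Lemma pen_step_le (R : realType) (K h k t s E S : R) :
  0 < h -> 0 < K -> 0 <= k -> 0 <= t -> K * h <= 1 -> 1 - E * h <= K * h -> `|s| <= S ->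
  K * (pen k (t + h * s) - pen k t)
    <= s * (k * t) + h * (E * S * (k * t)) + h * (k / 2 * S ^+ 2).
Proof.
move=> h0 K0 k0 t0 Kh1 Kh2 sS.
have := @pen_expand R k t (h * s) k0; rewrite (max_idPr t0) => le.
have : K * (pen k (t + h * s) - pen k t)
    <= K * (k * t * (h * s) + k / 2 * (h * s) ^+ 2).
  by rewrite ler_wpM2l //; lra.
move=> /le_trans; apply.
have p0 : 0 <= k * t by rewrite mulr_ge0.
have h1 : (1 - K * h) * (- s * (k * t)) <= E * h * (S * (k * t)).
  apply: (le_trans (y := (1 - K * h) * (S * (k * t)))).
    apply: ler_wpM2l; [lra..|].
    by rewrite ler_wpM2r // (le_trans _ sS) // -normrN ler_norm.
  apply: ler_wpM2r; [by rewrite mulr_ge0 // (le_trans _ sS)|lra].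
have h2 : K * h * (h * (k / 2 * s ^+ 2)) <= 1 * (h * (k / 2 * S ^+ 2)).
  rewrite ler_pM //.
  - by rewrite mulr_ge0; lra.
  - by apply: mulr_ge0; [lra|apply: mulr_ge0; [lra|exact: sqr_ge0]].
  apply: ler_wpM2l; [lra|].
  apply: ler_wpM2l; [lra|].
  by rewrite -(real_normK (num_real s)) ler_pXn2r // ?nnegrE // (le_trans _ sS).
lra.
Qed.

(** Here the ratio of the mesh sizes enters: the interpolation error, amplified by [K] of order
    [1 / h], is still O(h). *)
Lemma Kdx_le (R : realType) (K h dx a : R) :
  0 < h -> 0 < K -> K * h <= 1 -> 0 < dx -> 0 < a -> dx * a <= h ->
  K * dx ^+ 2 <= h * a^-1 ^+ 2.
Proof.
move=> h0 K0 Kh dx0 a0 dxa.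
have dh : dx <= h * a^-1 by rewrite ler_pdivlMr.
have : K * dx ^+ 2 <= K * (h * a^-1) ^+ 2.
  rewrite ler_wpM2l //; first exact: ltW.
  by rewrite ler_pXn2r // ?nnegrE ?mulr_ge0 ?invr_ge0 // ltW.
move=> /le_trans; apply.
have -> : K * (h * a^-1) ^+ 2 = K * h * (h * a^-1 ^+ 2) by ring.
by rewrite ler_piMl // mulr_ge0 ?sqr_ge0 // ltW.
Qed.

(** * Upper bound for the scheme *)

(** Dividing by [1 - d] turns the touching condition into a quadratic test of [v] itself, with slope
    [(k * (w - y) - d) / (1 - d)]. Slopes of a supersolution are nonnegative, whence the lower bound
    [d] on the penalty slope. *)
Lemma touch_super (R : realType) (m : model R) (v : idx -> R -> R) (j : idx)
    (d k w y : R) :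
  admissible m -> viscosity_supersol m v `]xl m, +oo[%classic ->
  0 < d < 1 -> 0 < k -> xl m < y ->
  (forall y', xl m <= y' -> (1 - d) * v j y + d * y + pen k (w - y)
     <= (1 - d) * v j y' + d * y' + pen k (w - y')) ->
  d <= k * (w - y) /\ forall c, 0 < c ->
    (1 - d) * (cu m c + lamj m j * (v (other j) y - v j y))
      + (r m * y + yj m j - c) * (k * (w - y) - d) <= (1 - d) * (rho m * v j y).
Proof.
move=> adm sup /andP[d0 d1] k0 xy H.
have [_ [_ [_ [_ [g1 _]]]]] := adm.
have Sy : `]xl m, +oo[%classic y by rewrite /= in_itv /= xy.
have d1' : 0 < 1 - d by lra.
(* On the flat side the penalty vanishes near [y], and the test slope would be
   [- d / (1 - d) < 0]. *)
have [t0|t0] := ltP (w - y) 0.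
  pose be := - d / (1 - d).
  have beE : (1 - d) * be = - d by rewrite /be; field; rewrite gt_eqF.
  have be0 : be < 0 by rewrite -(pmulr_rlt0 _ d1') beE; lra.
  have lm : loc_min_rel m (fun x => v j x - (0 * x ^+ 2 + be * x)) y.
    exists (y - w) => [|y' xy' yy']; first lra.
    rewrite -(ler_pM2l d1').
    have e x : (1 - d) * (v j x - (0 * x ^+ 2 + be * x))
      = (1 - d) * v j x - ((1 - d) * be) * x by ring.
    rewrite !e beE; have := H y' xy'; rewrite !pen_neg; [lra| |lra].
    by move: yy'; rewrite ltr_norml => /andP[]; lra.
  have := @slope_ge0 R m (r m * y + yj m j) _ _ _ g1
    (fun c c0 => @supersol_quad R m v _ j y 0 be c sup Sy lm c0).
  lra.
(* Up to a constant, [(1 - d) * (al * x ^+ 2 + be * x)] is [- d * x - k / 2 * (w - x) ^+ 2]. *)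
pose al := - (k / 2) / (1 - d); pose be := (k * w - d) / (1 - d).
have alE : (1 - d) * al = - (k / 2) by rewrite /al; field; rewrite gt_eqF.
have beE : (1 - d) * be = k * w - d by rewrite /be; field; rewrite gt_eqF.
have lm : loc_min_rel m (fun x => v j x - (al * x ^+ 2 + be * x)) y.
  exists 1 => // y' xy' _; rewrite -(ler_pM2l d1').
  have e x : (1 - d) * (v j x - (al * x ^+ 2 + be * x))
    = (1 - d) * v j x - ((1 - d) * al) * x ^+ 2 - ((1 - d) * be) * x by ring.
  rewrite !e alE beE; have := H y' xy'; rewrite (pen_pos k t0).
  have := @pen_le_quad R k (w - y') (ltW k0).
  lra.
have S c c0 := @supersol_quad R m v _ j y al be c sup Sy lm c0.
have := slope_ge0 g1 S.
set q := 2 * al * y + be in S * => q0.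
have qE : (1 - d) * q = k * (w - y) - d.
  have -> : (1 - d) * q = 2 * ((1 - d) * al) * y + (1 - d) * be by rewrite /q; ring.
  by rewrite alE beE; field.
split; first by rewrite -subr_ge0 -qE mulr_ge0 // ltW.
move=> c c0; have := S c c0; rewrite -(ler_pM2l d1') -qE => h.
by apply: le_trans h; rewrite le_eqVlt; apply/orP; left; apply/eqP; ring.
Qed.

(** At the doubled maximum, the scheme at [x] and the supersolution inequality at [y] are written
    with the same consumption and subtracted. What remains is the consistency error and the drift
    mismatch [r m * (x - y)] times the penalty slope. *)
Lemma upper_step (R : realType) (m : model R) (v : idx -> R -> R) (V : idx -> nat -> R)
    (h dx a d eta k kap sg B S j i y : _) :
  admissible m -> viscosity_supersol m v `]xl m, +oo[%classic ->
  scheme_sol m h dx V -> (forall j i, `|V j i| <= B) ->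
  0 < h -> 0 < dx -> rho m * h < 1 -> lam1 m * h < 1 -> lam2 m * h < 1 ->
  0 < a -> dx * a <= h -> 0 < d < 1 -> 0 < eta < 1 -> 0 < kap -> k = kap ^+ 2 ->
  kap * sg = 3 * eta ->
  (forall j' i' y', xl m <= y' ->
     V j' i' - (1 - d) * v j' y' - d * (gshift m + y') - pen k (grid m dx i' + sg - y')
     <= V j i - (1 - d) * v j y - d * (gshift m + y) - pen k (grid m dx i + sg - y)) ->
  xl m < y -> kap * (grid m dx i + sg - y) <= 2 * eta ->
  `|r m * grid m dx i + yj m j| <= S ->
  let Lam := lam1 m + lam2 m in let E := rho m + Lam in
  let C := (rho m + 2 * Lam) * B + 2 in let S3 := S + 4 * C / d in
  h * E <= 1 / 2 -> 4 * h * k * C < d ^+ 2 ->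
  h * (k / 2 * a^-1 ^+ 2) <= eta / 4 -> h * (E * S3 * (2 * eta * kap)) <= eta / 4 ->
  h * (k / 2 * S3 ^+ 2) <= eta / 4 -> h * (2 * rho m * Lam * B) <= eta / 4 ->
  rho m * (V j i - (1 - d) * v j y - d * (gshift m + y)) <= (6 * `|r m| + 2) * eta.
Proof.
move=> adm sup HV VB h0 dx0 rh l1h l2h a0 dxa d01 /andP[e0 e1] kap0 kE kapsg M xy kt xS.
move=> Lam E C S3 hE hk h1 h2 h3 h4.
set x := grid m dx i in M kt xS *; set t := x + sg - y in M kt.
have k0 : 0 < k by rewrite kE exprn_gt0.
have [rho0 [_ [_ [_ [g1 _]]]]] := adm.
have [K0 K1 K2] := schemeK_bounds j adm h0 rh l1h l2h.
have /andP[lj0 ljl] := lamj_bounds j adm.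
have Lam0 : 0 <= Lam by rewrite (le_trans lj0).
have B0 : 0 <= B by rewrite (le_trans _ (VB j i)).
have E0 : 0 <= E by rewrite /E; lra.
have C0 : 0 < C by rewrite /C ltr_wpDl // mulr_ge0 //; lra.
have [dp d1] : 0 < d /\ d < 1 by lra.
have [dkt SUP] : d <= k * t /\ forall c, 0 < c ->
    (1 - d) * (cu m c + lamj m j * (v (other j) y - v j y))
      + (r m * y + yj m j - c) * (k * t - d) <= (1 - d) * (rho m * v j y).
  apply: (@touch_super R m v j d k (x + sg) y) => // y' xy'.
  by have := M j i y' xy'; rewrite -/x -/t; lra.
have t0 : 0 < t by rewrite -(pmulr_rgt0 _ k0); lra.
have [c [c0 xz le]] := @scheme_le R m h dx V j i eta HV e0.
have c_le0 := cu_le0 c g1.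
move: xz le; rewrite {1}/drift -/x; set s := drift m dx j i c.
set z := x + h * s => xz le.
have sE : s = r m * x + yj m j - c by [].
have touch : 1 * (interp m dx (V j) z - V j i) <=
    pen k (z + sg - y) - pen k (x + sg - y) + k / 2 * dx ^+ 2.
  apply: (@interp_touch R m dx k 1 z (V j) i (fun x' => pen k (x' + sg - y))) => //.
  - exact: ltW.
  - move=> x'; exists (k * Num.max 0 (x' + sg - y)) => e.
    have -> : x' + e + sg - y = (x' + sg - y) + e by ring.
    by apply: pen_expand; exact: ltW.
  - by move=> n; have := M j n y (ltW xy); rewrite -/t -/x; lra.
have ztE : z + sg - y = t + h * s by rewrite /z /t; ring.
move: touch; rewrite mul1r ztE -/t => touch.
have Kdx : schemeK m h j * (k / 2 * dx ^+ 2) <= eta / 4.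
  have := Kdx_le h0 K0 K1 dx0 a0 dxa.
  have -> : schemeK m h j * (k / 2 * dx ^+ 2) = k / 2 * (schemeK m h j * dx ^+ 2) by ring.
  move=> q; apply: (le_trans (y := k / 2 * (h * a^-1 ^+ 2))).
    by apply: ler_wpM2l => //; clear -k0; lra.
  by move: h1; rewrite mulrCA.
set K := schemeK m h j in K0 K1 K2 le Kdx *.
have KI : K * (interp m dx (V j) z - V j i) <= K * (pen k (t + h * s) - pen k t) + eta / 4.
  apply: (le_trans (y := K * (pen k (t + h * s) - pen k t + k / 2 * dx ^+ 2))).
    by rewrite ler_wpM2l //; exact: ltW.
  by rewrite mulrDr; clear -Kdx; lra.
have Vb j' : - B <= V j' i <= B by rewrite -ler_norml.
have rh0 : 0 < rho m * h by rewrite mulr_gt0.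
have lamV : `|lamj m j * (V (other j) i - V j i)| <= 2 * Lam * B.
  rewrite normrM (ger0_norm lj0).
  have -> : 2 * Lam * B = Lam * (2 * B) by ring.
  by rewrite ler_pM // ler_norml; have := Vb j; have := Vb (other j); clear; lra.
have lamV2 : `|rho m * h * (lamj m j * (V (other j) i - V j i))| <= eta / 4.
  rewrite normrM (gtr0_norm rh0) (le_trans _ h4) //.
  have -> : h * (2 * rho m * Lam * B) = rho m * h * (2 * Lam * B) by ring.
  by rewrite ler_wpM2l // ltW.
have rV : - (rho m * B) <= rho m * V j i.
  by rewrite -mulrN ler_pM2l //; have := Vb j; clear; lra.
set LV := lamj m j * (V (other j) i - V j i) in lamV lamV2.
have LVE : (1 - rho m * h) * lamj m j * (V (other j) i - V j i) = LV - rho m * h * LV.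
  by rewrite /LV; ring.
rewrite LVE in le.
(* Near-optimality of [c] and the bounds on [V] keep the penalty increment above [- C]; [drift_lb]
   converts this into a bound on [s] independent of [h]. *)
have low : - C <= K * (pen k (t + h * s) - pen k t).
  move: lamV lamV2; rewrite !ler_norml => /andP[H1 H2] /andP[H3 H4].
  by rewrite /C; clear -le KI rV c_le0 e1 H1 H2 H3 H4; lra.
have Kh2 : 1 / 2 <= K * h by rewrite /E /Lam in hE; clear -hE K2; lra.
have sd := drift_lb h0 k0 t0 dp dkt C0 Kh2 hk low.
have sS : `|s| <= S3.
  rewrite ler_norml /S3; apply/andP; split.
    have : - s <= 4 * C / d by rewrite ler_pdivlMr // mulrC.
    by have := normr_ge0 (r m * x + yj m j); clear -xS; lra.
  have : 0 <= 4 * C / d by rewrite divr_ge0 ?mulr_ge0 // ltW.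
  by have := ler_norm (r m * x + yj m j); rewrite sE; clear -xS c0; lra.
have step : K * (pen k (t + h * s) - pen k t)
    <= s * (k * t) + h * (E * S3 * (k * t)) + h * (k / 2 * S3 ^+ 2).
  by apply: pen_step_le => //; try exact: ltW; rewrite /E /Lam; clear -K2; lra.
have pE : k * t <= 2 * eta * kap.
  have -> : k * t = kap * (kap * t) by rewrite kE; ring.
  by rewrite [leRHS]mulrC ler_wpM2l // ltW.
have S30 : 0 <= S3 by rewrite (le_trans _ sS).
have step2 : h * (E * S3 * (k * t)) <= eta / 4.
  apply: le_trans h2; rewrite ler_wpM2l //; first exact: ltW.
  by rewrite ler_wpM2l // mulr_ge0.
(* Utility and slope are split with weights [1 - d] and [d]: the first share is handled by [SUP],
   the second by the affine supersolution. *)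
have gs := gshift_super j adm (ltW xy) c0.
have gsd : d * (cu m c + (r m * y + yj m j - c)) <= d * (rho m * (gshift m + y)).
  by rewrite ler_wpM2l // ltW.
(* Maximality against the other income state at the same [i] and [y] controls the coupling. *)
have vo : LV <= lamj m j * ((1 - d) * (v (other j) y - v j y)).
  apply: ler_wpM2l => //; have := M (other j) i y (ltW xy); rewrite -/x; clear; lra.
have tsg : t < sg by rewrite -(ltr_pM2l kap0) kapsg; clear -kt e0; lra.
(* Since [k = kap ^+ 2], the product [sg * (k * t)] is [(kap * sg) * (kap * t)], at most
   [3 * eta * (2 * eta)]. *)
have xyp : r m * (x - y) * (k * t) <= `|r m| * (6 * eta).
  apply: (le_trans (ler_norm _)); rewrite -mulrA normrM.
  rewrite ler_wpM2l // normrM (@ger0_norm _ (k * t)); last by rewrite mulr_ge0 // ltW.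
  have xy1 : `|x - y| <= sg.
    by rewrite ler_norml; apply/andP; rewrite /t in t0 tsg; clear -t0 tsg; split; lra.
  apply: (le_trans (y := sg * (k * t))).
    by rewrite ler_wpM2r // mulr_ge0 // ltW.
  have -> : sg * (k * t) = (kap * sg) * (kap * t) by rewrite kE; ring.
  rewrite kapsg; have : 3 * eta * (kap * t) <= 3 * eta * (2 * eta).
    by apply: ler_wpM2l => //; clear -e0; lra.
  have : eta * eta <= eta * 1 by rewrite ler_wpM2l // ltW.
  by clear; lra.
have SUPc := SUP c c0.
have ek : s * (k * t) = (r m * y + yj m j - c) * (k * t) + r m * (x - y) * (k * t).
  by rewrite sE; ring.
move: lamV2; rewrite ler_norml => /andP[lv1 lv2].
clear -le KI step step2 h3 SUPc gsd vo xyp ek lv1.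
lra.
Qed.

Lemma grid_index_bound (R : realType) (m : model R) (dx L : R) : 0 < dx ->
  exists N, forall i, grid m dx i <= L -> (i <= N)%N.
Proof.
move=> dx0; exists (Num.truncn (`|L - xl m| / dx)).+1 => i; rewrite /grid => iL.
rewrite -(ler_nat R) ltW //; apply: le_lt_trans (truncnS_gt _).
rewrite ler_pdivlMr // (le_trans _ (ler_norm _)) //; lra.
Qed.

Lemma norm_r_bound (R : realType) (m : model R) (j : idx) (x L : R) :
  admissible m -> xl m <= x <= L ->
  `|r m * x + yj m j| <= `|r m| * (`|xl m| + `|L|) + y2 m.
Proof.
move=> adm /andP[xx xL]; rewrite (le_trans (ler_normD _ _)) // lerD //.
  rewrite normrM ler_wpM2l // ler_norml.
  have := ler_norm L; have := ler_norm (- xl m); rewrite normrN.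
  have := normr_ge0 L; have := normr_ge0 (xl m); lra.
have /andP[a b] := yj_bounds j adm.
have [_ [_ [y0 _]]] := adm; rewrite ger0_norm //; lra.
Qed.

Lemma scheme_upper (R : realType) (m : model R) (v : idx -> R -> R) (B a d eta : R) :
  admissible m -> (forall j, continuous (v j)) -> (forall j x, `|v j x| <= B) ->
  viscosity_supersol m v `]xl m, +oo[%classic ->
  0 < a -> 0 < d < 1 -> 0 < eta < 1 ->
  exists2 h0, 0 < h0 & forall h dx (V : idx -> nat -> R),
    0 < h -> 0 < dx -> rho m * h < 1 -> lam1 m * h < 1 -> lam2 m * h < 1 ->
    dx * a <= h -> h < h0 -> (forall j i, `|V j i| <= B) -> scheme_sol m h dx V ->
    forall j i, V j i <= (1 - d) * v j (grid m dx i) + d * (gshift m + grid m dx i)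
       + ((6 * `|r m| + 2) / rho m + 5) * eta.
Proof.
move=> adm cv vB sup a0 d01 e01.
have [/andP[d0 d1] /andP[e0 e1]] := (d01, e01).
have [rho0 _] := adm.
have B0 : 0 <= B by rewrite (le_trans _ (vB J1 0)).
pose L := xl m + (4 * B + 5) / d.
have e20 : 0 < eta ^+ 2 by rewrite exprn_gt0.
have [w1 w10 W1] := unif_continuous_segment (xl m) L (cv J1) e20.
have [w2 w20 W2] := unif_continuous_segment (xl m) L (cv J2) e20.
pose w := Num.min (Num.min w1 w2) (eta ^+ 2).
have w0 : 0 < w by rewrite !lt_min w10 w20 e20.
have we : w <= eta ^+ 2 by rewrite !ge_min lexx orbT.
have W j x z : xl m <= x <= L -> `|z - x| <= w -> `|v j z - v j x| <= eta ^+ 2.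
  by move=> xL xz; case: j; [apply: W1|apply: W2] => //;
    rewrite (le_trans xz) // !ge_min lexx ?orbT.
(* [Q / 2 = 4 * B + 5] bounds the oscillation of the bounded terms plus the penalty at the reference
   point; it therefore bounds localization term plus penalty at the maximum. *)
pose Q := 8 * B + 10.
have Q1 : 1 <= Q by rewrite /Q; lra.
(* Large enough that [kap * w > Q]: a maximum with [t > w] would pay a penalty above [Q / 2]. *)
pose kap := Q / w + 1.
have kapw : kap * w = Q + w by rewrite /kap; field; rewrite gt_eqF.
have kap1 : 1 <= kap.
  by rewrite /kap lerDr divr_ge0 //; [rewrite (le_trans _ Q1)|exact: ltW].
have kap0 : 0 < kap by exact: lt_le_trans kap1.
pose k := kap ^+ 2.
have k0 : 0 < k by rewrite exprn_gt0.
pose sg := 3 * eta / kap.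
have kapsg : kap * sg = 3 * eta by rewrite /sg; field; rewrite gt_eqF.
have sg0 : 0 < sg by rewrite /sg divr_gt0 // mulr_gt0.
have pensg : pen k sg = 9 / 2 * eta ^+ 2.
  rewrite pen_pos ?(ltW sg0) // /k.
  have -> : kap ^+ 2 / 2 * sg ^+ 2 = (kap * sg) ^+ 2 / 2 by field.
  by rewrite kapsg; field.
have eta2 : eta ^+ 2 <= eta by rewrite expr2 ler_piMl // ltW.
pose S := `|r m| * (`|xl m| + `|L + Q|) + y2 m.
pose Lam := lam1 m + lam2 m; pose E := rho m + Lam.
pose C := (rho m + 2 * Lam) * B + 2; pose S3 := S + 4 * C / d.
have Lam0 : 0 <= Lam by have /andP[p q] := lamj_bounds J1 adm; exact: le_trans q.
have S0 : 0 <= S.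
  rewrite /S addr_ge0 ?mulr_ge0 ?addr_ge0 //.
  by have [_ [_ [p [q _]]]] := adm; clear -p q; lra.
have C0 : 0 < C by rewrite /C ltr_wpDl // mulr_ge0 //; rewrite addr_ge0 ?mulr_ge0 // ltW.
have S30 : 0 <= S3 by rewrite /S3 addr_ge0 // divr_ge0 ?mulr_ge0 // ltW.
have E0 : 0 <= E by rewrite /E addr_ge0 // ltW.
(* One coefficient for each smallness condition on [h] in [upper_step]; [E] is added to [D]
   directly. *)
pose D1 := 4 * k * C / d ^+ 2; pose D2 := k / 2 * a^-1 ^+ 2.
pose D3 := E * S3 * (2 * eta * kap); pose D4 := k / 2 * S3 ^+ 2.
pose D5 := 2 * rho m * Lam * B.
have D10 : 0 <= D1 by rewrite /D1 divr_ge0 ?sqr_ge0 ?mulr_ge0 // ltW.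
have D20 : 0 <= D2 by rewrite /D2 mulr_ge0 ?sqr_ge0 // divr_ge0 // ltW.
have D30 : 0 <= D3 by rewrite /D3 !mulr_ge0 // ltW.
have D40 : 0 <= D4 by rewrite /D4 mulr_ge0 ?sqr_ge0 // divr_ge0 // ltW.
have D50 : 0 <= D5 by rewrite /D5 !mulr_ge0 // ltW.
pose D := 1 + E + D1 + D2 + D3 + D4 + D5.
have D0 : 0 < D by rewrite /D; clear -E0 D10 D20 D30 D40 D50; lra.
exists (eta / 4 / D); first by rewrite divr_gt0 // divr_gt0.
move=> h dx V h0 dx0 rh l1h l2h dxa; rewrite ltr_pdivlMr // => hD VB HV.
have small e : e <= D -> h * e <= eta / 4.
  by move=> eD; apply: ltW; apply: le_lt_trans hD; rewrite ler_wpM2l // ltW.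
have vb j x : - B <= v j x <= B by rewrite -ler_norml.
have Vb j i : - B <= V j i <= B by rewrite -ler_norml.
pose f j i y := V j i - (1 - d) * v j y - d * (gshift m + y) - pen k (grid m dx i + sg - y).
have dv j x : - B <= (1 - d) * v j x <= B.
  have := vb j x; clear -d0 d1 B0 => /andP[p q]; apply/andP; split; nra.
have loc j i y : xl m <= y -> f J1 0%N (xl m) <= f j i y ->
    d * (y - xl m) + pen k (grid m dx i + sg - y) <= Q / 2.
  move=> xy; rewrite /f.
  have -> : grid m dx 0 + sg - xl m = sg by rewrite /grid; ring.
  rewrite pensg /Q; have := dv J1 (xl m); have := dv j y; have := Vb J1 0%N; have := Vb j i.
  clear -eta2 e1; lra.
have locL j i y : xl m <= y -> f J1 0%N (xl m) <= f j i y ->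
    y <= L /\ grid m dx i <= L + Q.
  move=> xy fy; have := loc j i y xy fy => l.
  have yL : y <= L.
    have : y - xl m <= Q / 2 / d.
      rewrite ler_pdivlMr // mulrC.
      by have := pen_ge0 (grid m dx i + sg - y) (ltW k0); clear -l; lra.
    have -> : Q / 2 = 4 * B + 5 by rewrite /Q; field.
    by rewrite /L; clear; lra.
  split=> //; rewrite leNgt; apply/negP => gL.
  have tQ : Q <= grid m dx i + sg - y by clear -gL yL sg0; lra.
  have : k / 2 * (grid m dx i + sg - y) ^+ 2 <= Q / 2.
    rewrite -pen_pos; last by clear -tQ Q1; lra.
    have : 0 <= d * (y - xl m) by rewrite mulr_ge0 ?subr_ge0 // ltW.
    by clear -l; lra.
  have : 1 / 2 * Q ^+ 2 <= k / 2 * (grid m dx i + sg - y) ^+ 2.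
    rewrite ler_pM ?sqr_ge0 //.
      by rewrite ler_pM2r ?invr_gt0 // /k expr_ge1 // ltW.
    by rewrite ler_pXn2r // nnegrE; clear -tQ Q1; lra.
  have Q1' : 9 < Q by rewrite /Q; clear -B0; lra.
  by clear -Q1'; nra.
have cf j i : continuous (f j i).
  move=> y; rewrite /f; apply: cvgB; last first.
    apply: (@continuous_pen _ _ (fun y => grid m dx i + sg - y)) => x.
    by apply: cvgB; [exact: cvg_cst|exact: cvg_id].
  apply: cvgB; last first.
    apply: cvgM; first exact: cvg_cst.
    by apply: cvgD; [exact: cvg_cst|exact: cvg_id].
  apply: cvgB; first exact: cvg_cst.
  by apply: cvgM; [exact: cvg_cst|exact: cv].
have [N HN] := grid_index_bound m (L + Q) dx0.
have [j [i [y [xy M]]]] : exists j i y, xl m <= y /\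
    forall j' i' y', xl m <= y' -> f j' i' y' <= f j i y.
  apply: (@max_attained R f (xl m) L N cf) => j i y xy fy.
  by have [p q] := locL j i y xy fy; split=> //; exact: HN.
have [yL gL] := locL j i y xy (M J1 0%N (xl m) (lexx _)).
have l := loc j i y xy (M J1 0%N (xl m) (lexx _)).
have xg := grid_ge m i dx0.
pose t := grid m dx i + sg - y.
(* Comparing the maximum with [grid m dx i + sg], where the penalty vanishes, bounds the penalty by
   the modulus of continuity of [v] plus [d * t]. *)
have pent_of : 0 < t -> kap * t <= 2 * eta.
  move=> t0.
  have tw : t <= w.
    rewrite leNgt; apply/negP => wt.
    have : k / 2 * t ^+ 2 <= Q / 2.
      rewrite -pen_pos ?(ltW t0) //.
      have : 0 <= d * (y - xl m) by rewrite mulr_ge0 ?subr_ge0 // ltW.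
      by rewrite /t; clear -l; lra.
    have : Q < kap * t.
      apply: (lt_trans (y := kap * w)); first by rewrite kapw; clear -w0; lra.
      by rewrite ltr_pM2l.
    have -> : k / 2 * t ^+ 2 = (kap * t) ^+ 2 / 2 by rewrite /k; field.
    by move: (kap * t) => T; clear -Q1; nra.
  have := M j i (grid m dx i + sg) ltac:(clear -xg sg0; lra).
  rewrite /f subrr pen_neg // -/t => Mt.
  have := W j y (grid m dx i + sg) ltac:(by rewrite xy) ltac:(by rewrite -/t gtr0_norm).
  rewrite ler_norml => /andP[_ Wt].
  have : pen k t <= 2 * eta ^+ 2.
    have : (1 - d) * (v j (grid m dx i + sg) - v j y) <= 1 * eta ^+ 2.
      by clear -Wt d0 d1 e20; nra.
    have : d * t <= 1 * eta ^+ 2.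
      by rewrite ler_pM // ?(ltW d0) ?(ltW d1) ?(ltW t0) // (le_trans tw).
    have tE : d * t = d * (gshift m + (grid m dx i + sg)) - d * (gshift m + y).
      by rewrite /t; ring.
    by move: Mt; clear -tE; lra.
  rewrite pen_pos ?(ltW t0) // => p.
  have : (kap * t) ^+ 2 <= (2 * eta) ^+ 2 by move: p; rewrite /k; clear; lra.
  by rewrite ler_pXn2r // ?nnegrE ?mulr_ge0 // ltW.
(* At [y = xl m] the shift would force [kap * t >= 3 * eta], against [kap * t <= 2 * eta]. *)
have xyS : xl m < y.
  rewrite lt_neqAle xy andbT; apply/eqP => xyE.
  have t0 : 0 < t by rewrite /t -xyE; clear -xg sg0; lra.
  have := pent_of t0.
  have : kap * sg <= kap * t.
    by rewrite ler_wpM2l ?(ltW kap0) // /t -xyE; clear -xg; lra.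
  by rewrite kapsg; clear -e0; lra.
have kt : kap * t <= 2 * eta.
  have [t0|t0] := ltP 0 t; first exact: pent_of.
  apply: (le_trans (y := 0)); last by rewrite mulr_ge0 // ltW.
  by rewrite mulr_ge0_le0 // ltW.
have step : rho m * (V j i - (1 - d) * v j y - d * (gshift m + y)) <= (6 * `|r m| + 2) * eta.
  apply: (@upper_step R m v V h dx a d eta k kap sg B S j i y) => //.
  - by apply: norm_r_bound => //; rewrite xg.
  - rewrite -/Lam -/E; have := small E; rewrite /D.
    by clear -E0 D10 D20 D30 D40 D50 e1 => H; have := H ltac:(lra); lra.
  - rewrite -/Lam -/C; have := small D1; rewrite {1}/D => H.
    have {}H := H ltac:(clear -E0 D10 D20 D30 D40 D50; lra).
    have d20 : 0 < d ^+ 2 by rewrite exprn_gt0.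
    have : h * D1 < 1 by clear -H e1; lra.
    have -> : h * D1 = 4 * h * k * C / d ^+ 2 by rewrite /D1; ring.
    by rewrite ltr_pdivrMr // mul1r.
  - by apply: small; rewrite -/D2 /D; clear -E0 D10 D20 D30 D40 D50; lra.
  - by apply: small; rewrite -/Lam -/E -/C -/S3 -/D3 /D; clear -E0 D10 D20 D30 D40 D50; lra.
  - by apply: small; rewrite -/Lam -/C -/S3 -/D4 /D; clear -E0 D10 D20 D30 D40 D50; lra.
  - by apply: small; rewrite -/Lam -/D5 /D; clear -E0 D10 D20 D30 D40 D50; lra.
(* Taking both variables at the same grid point costs the penalty of the bare shift,
   [9 / 2 * eta ^+ 2 <= 5 * eta]. *)
move=> j' i'; have := M j' i' (grid m dx i') (grid_ge m i' dx0).
rewrite /f; have -> : grid m dx i' + sg - grid m dx i' = sg by ring.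
have {}step : V j i - (1 - d) * v j y - d * (gshift m + y)
    <= (6 * `|r m| + 2) / rho m * eta.
  by rewrite mulrAC ler_pdivlMr // mulrC.
rewrite pensg; have := pen_ge0 (grid m dx i + sg - y) (ltW k0).
by clear -step eta2 e0; lra.
Qed.

(** * Lower bound for the scheme *)

(** Discrete counterpart of [touch_super]: now the scheme is the supersolution, tested from below
    with slope [p - d], so the inequality holds for every admissible consumption of bounded drift,
    up to O(h). *)
Lemma lower_ineq (R : realType) (m : model R) (V : idx -> nat -> R)
    (h dx a d k w S pm c : R) (j : idx) (i : nat) :
  admissible m -> scheme_sol m h dx V ->
  0 < h -> 0 < dx -> rho m * h < 1 -> lam1 m * h < 1 -> lam2 m * h < 1 ->
  0 < a -> dx * a <= h -> 0 < d < 1 -> 0 < k ->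
  (forall n, (1 - d) * V j i + d * grid m dx i + pen k (w - grid m dx i)
     <= (1 - d) * V j n + d * grid m dx n + pen k (w - grid m dx n)) ->
  0 < c -> xl m <= grid m dx i + h * drift m dx j i c ->
  `|drift m dx j i c| <= S -> k * Num.max 0 (w - grid m dx i) <= pm ->
  (1 - d) * cu m c + drift m dx j i c * (k * Num.max 0 (w - grid m dx i) - d)
    - (h * ((rho m + (lam1 m + lam2 m)) * S * (pm + 1))
       + h * (k / 2 * S ^+ 2) + h * (k / 2 * a^-1 ^+ 2))
  <= (1 - d) * (rho m * V j i
                - (1 - rho m * h) * lamj m j * (V (other j) i - V j i)).
Proof.
move=> adm HV h0 dx0 rh l1h l2h a0 dxa /andP[d0 d1] k0 M c0 xz sS ppm.
have [K0 K1 K2] := schemeK_bounds j adm h0 rh l1h l2h.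
have sch := scheme_ge HV c0 xz.
move: xz sS sch; set s := drift m dx j i c; set x := grid m dx i => xz sS sch.
set z := x + h * s in xz sch.
set p := k * Num.max 0 (w - x) in ppm *.
have p0 : 0 <= p by rewrite mulr_ge0 ?le_max ?lexx // ltW.
have touch : - (1 - d) * (interp m dx (V j) z - V j i) <=
    (d * z + pen k (w - z)) - (d * x + pen k (w - x)) + k / 2 * dx ^+ 2.
  apply: (@interp_touch R m dx k (- (1 - d)) z (V j) i (fun x' => d * x' + pen k (w - x'))) => //.
  - exact: ltW.
  - move=> x'; exists (d - k * Num.max 0 (w - x')) => e.
    have := @pen_expand R k (w - x') (- e) (ltW k0).
    have -> : w - (x' + e) = w - x' - e by ring.
    by clear; lra.
  - by move=> n; have := M n; rewrite -/x; clear; lra.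
have ex := @pen_expand R k (w - x) (- (h * s)) (ltW k0).
have e1 : w - z = w - x - h * s by rewrite /z; ring.
move: touch; rewrite e1 => touch.
set K := schemeK m h j in K0 K1 K2 sch.
have Kt : K * (h * s * (p - d) - k / 2 * (h * s) ^+ 2 - k / 2 * dx ^+ 2)
    <= K * ((1 - d) * (interp m dx (V j) z - V j i)).
  rewrite ler_wpM2l //; first exact: ltW.
  by move: ex touch; rewrite -/p /z; clear; lra.
have S0 : 0 <= S by rewrite (le_trans _ sS).
have r1 : (1 - K * h) * (s * (p - d)) <= h * ((rho m + (lam1 m + lam2 m)) * S * (pm + 1)).
  have -> : h * ((rho m + (lam1 m + lam2 m)) * S * (pm + 1))
     = ((rho m + lam1 m + lam2 m) * h) * (S * (pm + 1)) by ring.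
  apply: (le_trans (y := (1 - K * h) * (S * (pm + 1)))).
    apply: ler_wpM2l; first by clear -K1; lra.
    rewrite (le_trans (ler_norm _)) // normrM ler_pM // ler_norml.
    by clear -p0 ppm d0 d1; lra.
  apply: ler_wpM2r; last by clear -K2; lra.
  by rewrite mulr_ge0 //; clear -p0 ppm; lra.
have r2 : K * h * (h * (k / 2 * s ^+ 2)) <= 1 * (h * (k / 2 * S ^+ 2)).
  rewrite ler_pM //.
  - by rewrite mulr_ge0 // ltW.
  - by rewrite mulr_ge0 ?(ltW h0) // mulr_ge0 ?sqr_ge0 // divr_ge0 // ltW.
  rewrite ler_wpM2l ?(ltW h0) // ler_wpM2l ?divr_ge0 ?(ltW k0) //.
  by rewrite -(real_normK (num_real s)) ler_pXn2r // ?nnegrE.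
have r3 : K * (k / 2 * dx ^+ 2) <= h * (k / 2 * a^-1 ^+ 2).
  have -> : h * (k / 2 * a^-1 ^+ 2) = k / 2 * (h * a^-1 ^+ 2) by ring.
  have -> : K * (k / 2 * dx ^+ 2) = k / 2 * (K * dx ^+ 2) by ring.
  by rewrite ler_wpM2l ?divr_ge0 ?(ltW k0) //; exact: Kdx_le.
have := sch; rewrite -(@ler_pM2l _ (1 - d)); last by clear -d1; lra.
by move: Kt r1 r2 r3; clear; lra.
Qed.

(** The penalty lies below the full quadratic and meets it at [x], because [0 <= x + u]; the
    quadratic is thus a legitimate smooth test function. *)
Lemma touch_sub (R : realType) (m : model R) (v : idx -> R -> R) (j : idx)
    (k u x e : R) :
  viscosity_subsol m v `[xl m, +oo[%classic ->
  0 < k -> xl m <= x -> 0 <= x + u -> 0 < e ->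
  (forall x', xl m <= x' -> v j x' - pen k (x' + u) <= v j x - pen k (x + u)) ->
  exists2 c, 0 < c & rho m * v j x - e <= cu m c
    + (r m * x + yj m j - c) * (k * (x + u)) + lamj m j * (v (other j) x - v j x).
Proof.
move=> sub k0 xx xu e0 H.
have Sx : `[xl m, +oo[%classic x by rewrite /= in_itv /= xx.
have lm : loc_max_rel m (fun x => v j x - (k / 2 * x ^+ 2 + k * u * x)) x.
  exists 1 => // x' xx' _; have := H x' xx'; rewrite (pen_pos k xu).
  have := @pen_le_quad R k (x' + u) (ltW k0); clear; lra.
have [c c0 le] := subsol_quad sub Sx lm e0.
exists c => //; apply: (le_trans le); rewrite le_eqVlt; apply/orP; left; apply/eqP.
by field.
Qed.

(* The slope of the penalty at a maximum near the boundary is bounded by [P],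
   because a small consumption [c0 / 4] yields a strictly inward drift there;
   the shift [4 * P / k] then keeps the grid point away from the boundary. *)
Lemma scheme_lower (R : realType) (m : model R) (v : idx -> R -> R) (B a d eta : R) :
  admissible m -> (forall j, continuous (v j)) -> (forall j x, `|v j x| <= B) ->
  viscosity_subsol m v `[xl m, +oo[%classic ->
  0 < a -> 0 < d < 1 -> 0 < eta < 1 ->
  exists2 h0, 0 < h0 & forall h dx (V : idx -> nat -> R),
    0 < h -> 0 < dx -> rho m * h < 1 -> lam1 m * h < 1 -> lam2 m * h < 1 ->
    dx * a <= h -> h < h0 -> (forall j i, `|V j i| <= B) -> scheme_sol m h dx V ->
    forall j i, v j (grid m dx i) <= (1 - d) * V j i + d * (gshift m + grid m dx i)
       + ((5 * `|r m| + 3) / rho m + 1) * eta.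
Proof.
move=> adm cv vB sub a0 d01 e01.
have [/andP[d0 d1] /andP[e0 e1]] := (d01, e01).
have [rho0 [rrho [_ [_ [g1 [xl0 [c00 _]]]]]]] := adm.
set c0 := rho m * xl m + y1 m in c00.
have B0 : 0 <= B by rewrite (le_trans _ (vB J1 0)).
pose L := xl m + (4 * B + 5) / d.
pose Q := 8 * B + 10.
have Q1 : 1 <= Q by rewrite /Q; clear -B0; lra.
pose S := `|r m| * (`|xl m| + `|L + Q|) + y2 m.
pose Lam := lam1 m + lam2 m; pose E := rho m + Lam.
pose C := (rho m + 2 * Lam) * B.
have Lam0 : 0 <= Lam by have /andP[p q] := lamj_bounds J1 adm; exact: le_trans q.
have S0 : 0 <= S.
  rewrite /S addr_ge0 ?mulr_ge0 ?addr_ge0 //.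
  by have [_ [_ [p [q _]]]] := adm; clear -p q; lra.
have C0 : 0 <= C by rewrite /C mulr_ge0 // addr_ge0 ?mulr_ge0 // ltW.
have E0 : 0 <= E by rewrite /E addr_ge0 // ltW.
pose u1 := (1 - gam m)^-1.
have u10 : u1 <= 0 by rewrite /u1 invr_le0; clear -g1; lra.
have cu10 := cu_le0 (c0 / 4) g1.
(* Solves [c0 / 4 * (P - 1) = C + 1 - cu m (c0 / 4)]: a larger slope combined with an inward drift
   [c0 / 4] would exceed the bound [Gub]. *)
pose P := 1 + 4 * (C + 1 - cu m (c0 / 4)) / c0.
have P1 : 1 <= P.
  by rewrite /P lerDl divr_ge0 ?(ltW c00) //; clear -C0 cu10; lra.
have P0 : 0 < P by exact: lt_le_trans P1.
have [w1 w10 W1] := unif_continuous_segment (xl m) (L + Q) (cv J1) e0.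
have [w2 w20 W2] := unif_continuous_segment (xl m) (L + Q) (cv J2) e0.
pose w := Num.min (Num.min w1 w2) (eta / (4 * P)).
have eP : 0 < eta / (4 * P) by rewrite divr_gt0 // mulr_gt0.
have w0 : 0 < w by rewrite !lt_min w10 w20 eP.
have wP : 4 * P * w <= eta.
  by rewrite mulrC -ler_pdivlMr ?mulr_gt0 // !ge_min lexx orbT.
have W j x z : xl m <= x <= L + Q -> `|z - x| <= w -> `|v j z - v j x| <= eta.
  by move=> xL xz; case: j; [apply: W1|apply: W2] => //;
    rewrite (le_trans xz) // !ge_min lexx ?orbT.
(* In turn, these make [t <= w], keep [pen k sg] below [eta], and keep [|r m| * sg] below [c0]. *)
pose k1 := Q / w ^+ 2; pose k2 := 8 * P ^+ 2 / eta; pose k3 := 4 * P * `|r m| / c0.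
have w20' : 0 < w ^+ 2 by rewrite exprn_gt0.
have k10 : 0 <= k1 by rewrite divr_ge0 // ?(ltW w20') // (le_trans _ Q1).
have k20 : 0 <= k2 by rewrite divr_ge0 ?(ltW e0) // mulr_ge0 // sqr_ge0.
have k30 : 0 <= k3 by rewrite divr_ge0 ?(ltW c00) // !mulr_ge0 // ltW.
pose k := 1 + k1 + k2 + k3.
have k1' : 1 <= k by rewrite /k; clear -k10 k20 k30; lra.
have k0 : 0 < k by exact: lt_le_trans k1'.
have kw : Q <= k * w ^+ 2.
  by rewrite -ler_pdivrMr // -/k1 /k; clear -k10 k20 k30; lra.
have kP : 8 * P ^+ 2 <= k * eta.
  by rewrite -ler_pdivrMr // -/k2 /k; clear -k10 k20 k30; lra.
have kr : 4 * P * `|r m| <= k * c0.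
  by rewrite -ler_pdivrMr // -/k3 /k; clear -k10 k20 k30; lra.
pose sg := 4 * P / k.
have ksg : k * sg = 4 * P by rewrite /sg; field; rewrite gt_eqF.
have sg0 : 0 < sg by rewrite /sg divr_gt0 // mulr_gt0.
have pensg : pen k sg <= eta.
  rewrite pen_pos ?(ltW sg0) // -(ler_pM2l k0).
  have -> : k * (k / 2 * sg ^+ 2) = (k * sg) ^+ 2 / 2 by field.
  by rewrite ksg; move: kP; clear; lra.
have rsg : `|r m| * sg <= c0.
  rewrite -(ler_pM2l k0); have -> : k * (`|r m| * sg) = k * sg * `|r m| by ring.
  by rewrite ksg.
(* Solves [W' * (d / 2) = C + 2 - u1]: if the slope were below [d / 2], consuming [W'] in excess of
   income would exceed [Gub]. *)
pose W' := 2 * (C + 2 - u1) / d.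
have W'0 : 0 <= W' by rewrite /W' divr_ge0 ?(ltW d0) //; clear -C0 u10; lra.
pose S3 := 2 * S + 1 + W' + c0.
have S30 : 0 <= S3 by rewrite /S3; clear -S0 W'0 c00; lra.
pose D1 := E * S3 * (k * Q + 1); pose D2 := k / 2 * S3 ^+ 2.
(* [D5] forces [h * S3 <= sg / 2], so that one step from a point at distance [sg / 2] from the
   boundary remains in the domain. *)
pose D3 := k / 2 * a^-1 ^+ 2; pose D4 := 2 * rho m * Lam * B; pose D5 := 2 * S3 / sg.
have D10 : 0 <= D1.
  rewrite /D1 !mulr_ge0 // addr_ge0 // mulr_ge0 ?(ltW k0) //.
  exact: le_trans Q1.
have D20 : 0 <= D2 by rewrite /D2 mulr_ge0 ?sqr_ge0 // divr_ge0 // ltW.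
have D30 : 0 <= D3 by rewrite /D3 mulr_ge0 ?sqr_ge0 // divr_ge0 // ltW.
have D40 : 0 <= D4 by rewrite /D4 !mulr_ge0 // ltW.
have D50 : 0 <= D5 by rewrite /D5 divr_ge0 ?(ltW sg0) // mulr_ge0.
pose D := 1 + D1 + D2 + D3 + D4 + D5.
have D0 : 0 < D by rewrite /D; clear -D10 D20 D30 D40 D50; lra.
exists (eta / 4 / D); first by rewrite divr_gt0 // divr_gt0.
move=> h dx V h0 dx0 rh l1h l2h dxa; rewrite ltr_pdivlMr // => hD VB HV.
have small e : e <= D -> h * e <= eta / 4.
  by move=> eD; apply: ltW; apply: le_lt_trans hD; rewrite ler_wpM2l // ltW.
have hD1 : h * D1 <= eta / 4.
  by apply: small; rewrite /D; clear -D10 D20 D30 D40 D50; lra.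
have hD2 : h * D2 <= eta / 4.
  by apply: small; rewrite /D; clear -D10 D20 D30 D40 D50; lra.
have hD3 : h * D3 <= eta / 4.
  by apply: small; rewrite /D; clear -D10 D20 D30 D40 D50; lra.
have hD4 : h * D4 <= eta / 4.
  by apply: small; rewrite /D; clear -D10 D20 D30 D40 D50; lra.
have hS3 : h * S3 <= sg / 2.
  have : h * D5 <= eta / 4.
    by apply: small; rewrite /D; clear -D10 D20 D30 D40 D50; lra.
  have -> : h * D5 = 2 * (h * S3) / sg by rewrite /D5; ring.
  rewrite ler_pdivrMr // => q.
  have : eta / 4 * sg <= 1 * sg by rewrite ler_wpM2r ?(ltW sg0) //; clear -e1; lra.
  by clear -q; lra.
clear small hD.
have vb j x : - B <= v j x <= B by rewrite -ler_norml.
have Vb j i : - B <= V j i <= B by rewrite -ler_norml.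
pose f j i x := v j x - (1 - d) * V j i - d * (gshift m + grid m dx i)
  - pen k (x + sg - grid m dx i).
have dV j i : - B <= (1 - d) * V j i <= B.
  have := Vb j i; clear -d0 d1 B0 => /andP[p q]; apply/andP; split; nra.
have loc j i x : xl m <= x -> f J1 0%N (xl m) <= f j i x ->
    d * (grid m dx i - xl m) + pen k (x + sg - grid m dx i) <= Q / 2.
  move=> xx; rewrite /f.
  have -> : grid m dx 0 = xl m by rewrite /grid; ring.
  have -> : xl m + sg - xl m = sg by ring.
  rewrite /Q; have := dV J1 0%N; have := dV j i; have := vb J1 (xl m); have := vb j x.
  by clear -pensg e1; lra.
have locL j i x : xl m <= x -> f J1 0%N (xl m) <= f j i x ->
    grid m dx i <= L /\ x <= L + Q.
  move=> xx fx; have := loc j i x xx fx => l.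
  have gL : grid m dx i <= L.
    have : grid m dx i - xl m <= Q / 2 / d.
      rewrite ler_pdivlMr // mulrC.
      by have := pen_ge0 (x + sg - grid m dx i) (ltW k0); clear -l; lra.
    have -> : Q / 2 = 4 * B + 5 by rewrite /Q; field.
    by rewrite /L; clear; lra.
  split=> //; rewrite leNgt; apply/negP => xL.
  have tQ : Q <= x + sg - grid m dx i by clear -gL xL sg0; lra.
  have : k / 2 * (x + sg - grid m dx i) ^+ 2 <= Q / 2.
    rewrite -pen_pos; last by clear -tQ Q1; lra.
    have : 0 <= d * (grid m dx i - xl m).
      by rewrite mulr_ge0 ?subr_ge0 ?grid_ge // ltW.
    by clear -l; lra.
  have : 1 / 2 * Q ^+ 2 <= k / 2 * (x + sg - grid m dx i) ^+ 2.
    rewrite ler_pM ?sqr_ge0 //.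
      by rewrite ler_pM2r ?invr_gt0.
    by rewrite ler_pXn2r // nnegrE; clear -tQ Q1; lra.
  have Q1' : 9 < Q by rewrite /Q; clear -B0; lra.
  by clear -Q1'; nra.
have cf j i : continuous (f j i).
  move=> y; rewrite /f; apply: cvgB; last first.
    apply: (@continuous_pen _ _ (fun y => y + sg - grid m dx i)) => x.
    by apply: cvgB; [apply: cvgD; [exact: cvg_id|exact: cvg_cst]|exact: cvg_cst].
  by apply: cvgB; [apply: cvgB; [exact: cv|exact: cvg_cst]|exact: cvg_cst].
have [N HN] := grid_index_bound m L dx0.
have [j [i [x [xx M]]]] : exists j i x, xl m <= x /\
    forall j' i' x', xl m <= x' -> f j' i' x' <= f j i x.
  apply: (@max_attained R f (xl m) (L + Q) N cf) => j i x xx fx.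
  by have [p q] := locL j i x xx fx; split=> //; exact: HN.
have [gL xL] := locL j i x xx (M J1 0%N (xl m) (lexx _)).
have l := loc j i x xx (M J1 0%N (xl m) (lexx _)).
clear loc locL HN.
have xg := grid_ge m i dx0.
set y := grid m dx i in M gL l xg *.
pose t := x + sg - y; pose p := k * Num.max 0 t.
have Q0 : 0 < Q by exact: lt_le_trans Q1.
have pent : pen k t <= Q / 2.
  have : 0 <= d * (y - xl m) by rewrite mulr_ge0 ?subr_ge0 // ltW.
  by rewrite /t; clear -l; lra.
have p0 : 0 <= p by rewrite /p mulr_ge0 ?le_max ?lexx // ltW.
have pkQ : p <= k * Q.
  rewrite /p ler_pM2l // ge_max (ltW Q0) /=.
  rewrite leNgt; apply/negP => tQ.
  have : 1 / 2 * Q ^+ 2 < pen k t.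
    rewrite pen_pos; last by clear -tQ Q0; lra.
    apply: (lt_le_trans (y := 1 / 2 * t ^+ 2)).
      by rewrite ltr_pM2l ?divr_gt0 // ltr_pXn2r // ?nnegrE; clear -tQ Q0; lra.
    by rewrite ler_wpM2r ?sqr_ge0 // ler_pM2r ?invr_gt0.
  by clear -pent Q1; nra.
have ry z : xl m <= z <= L + Q -> `|r m * z + yj m j| <= S.
  by move=> zz; apply: norm_r_bound.
have ryS : - S <= r m * y + yj m j <= S.
  by rewrite -ler_norml; apply: ry; clear -xg gL Q1; lra.
have rxS : - S <= r m * x + yj m j <= S by rewrite -ler_norml; apply: ry; rewrite xx.
have /andP[lj0 ljl] := lamj_bounds j adm; rewrite -/Lam in ljl.
pose LV := lamj m j * (V (other j) i - V j i).
have LVb : - (2 * Lam * B) <= LV <= 2 * Lam * B.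
  rewrite -ler_norml /LV normrM (ger0_norm lj0).
  have -> : 2 * Lam * B = Lam * (2 * B) by ring.
  rewrite ler_pM // ler_norml; have := Vb j i; have := Vb (other j) i.
  by clear; lra.
have Lvb : `|lamj m j * (v (other j) x - v j x)| <= 2 * Lam * B.
  rewrite normrM (ger0_norm lj0).
  have -> : 2 * Lam * B = Lam * (2 * B) by ring.
  rewrite ler_pM // ler_norml; have := vb j x; have := vb (other j) x.
  by clear; lra.
have rh0 : 0 < rho m * h by rewrite mulr_gt0.
have LV2 : - (eta / 4) <= rho m * h * LV <= eta / 4.
  rewrite -ler_norml normrM (gtr0_norm rh0) (le_trans _ hD4) // /D4.
  have -> : h * (2 * rho m * Lam * B) = rho m * h * (2 * Lam * B) by ring.
  by rewrite ler_wpM2l ?(ltW rh0) // ler_norml.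
have LVE : (1 - rho m * h) * lamj m j * (V (other j) i - V j i) = LV - rho m * h * LV.
  by rewrite /LV; ring.
have G c : 0 < c -> `|r m * y + yj m j - c| <= S3 ->
    xl m <= y + h * (r m * y + yj m j - c) ->
    (1 - d) * cu m c + (r m * y + yj m j - c) * (p - d) - 3 * (eta / 4)
    <= (1 - d) * (rho m * V j i - (LV - rho m * h * LV)).
  move=> c0' sS xz; rewrite -LVE.
  have := @lower_ineq R m V h dx a d k (x + sg) S3 (k * Q) c j i adm HV h0 dx0
    rh l1h l2h a0 dxa d01 k0.
  rewrite /drift -/y -/t -/p => H.
  have {}H := H ltac:(by move=> n; have := M j n x xx; rewrite /f -/y; clear; lra) c0' xz sS pkQ.
  move: H hD1 hD2 hD3; rewrite -/Lam -/E -/D1 -/D2 -/D3.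
  by clear; lra.
have Gub : (1 - d) * (rho m * V j i - (LV - rho m * h * LV)) <= C + eta / 4.
  have rV : rho m * V j i <= rho m * B.
    by rewrite ler_pM2l //; have := Vb j i; clear => /andP[].
  have X0 : rho m * V j i - (LV - rho m * h * LV) <= C + eta / 4.
    by rewrite /C; clear -rV LVb LV2; lra.
  by clear -X0 d0 d1 C0 e0; nra.
have dcu c : cu m c <= (1 - d) * cu m c.
  by have := cu_le0 c g1; clear -d0; nra.
(* Closer to the boundary one has [t > sg / 2], hence slope above [2 * P], while consumption
   [c0 / 4] keeps the drift at least [c0 / 4]: a contradiction with [Gub]. *)
have ysg : xl m + sg / 2 <= y.
  rewrite leNgt; apply/negP => ylt.
  have tsg : sg / 2 < t by rewrite /t; clear -ylt xx; lra.
  have pP : 2 * P < p.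
    rewrite /p (max_idPr _); last by clear -tsg sg0; lra.
    have -> : 2 * P = k * (sg / 2) by rewrite mulrA ksg; field.
    by rewrite ltr_pM2l.
  have s1 : c0 / 4 <= r m * y + yj m j - c0 / 4.
    have rr : `|r m * (y - xl m)| <= c0 / 2.
      rewrite normrM (@ger0_norm _ (y - xl m)) ?subr_ge0 //.
      apply: (le_trans (y := `|r m| * (sg / 2))); last by clear -rsg; lra.
      by rewrite ler_wpM2l //; clear -ylt; lra.
    move: rr; rewrite ler_norml => /andP[rr _].
    have /andP[yy _] := yj_bounds j adm.
    have : 0 <= (rho m - r m) * (- xl m) by rewrite mulr_ge0; clear -rrho xl0; lra.
    by rewrite /c0 in rr *; clear -rr yy; lra.
  have := G (c0 / 4) ltac:(by rewrite divr_gt0) ltac:(rewrite ler_norml /S3;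
    clear -s1 ryS S0 W'0 c00; lra) ltac:(have : 0 <= h * (r m * y + yj m j - c0 / 4);
      [by rewrite mulr_ge0 ?(ltW h0) //; clear -s1 c00; lra|clear -xg; lra]).
  have := dcu (c0 / 4).
  have : c0 / 4 * (p - 1) <= (r m * y + yj m j - c0 / 4) * (p - d).
    by rewrite ler_pM //; clear -c00 pP P1 d1 s1; lra.
  have Pp : c0 / 4 * (P - 1) = C + 1 - cu m (c0 / 4).
    by rewrite /P; field; rewrite gt_eqF.
  have : c0 / 4 * (P - 1) < c0 / 4 * (p - 1).
    by rewrite ltr_pM2l ?divr_gt0 //; clear -pP P1; lra.
  by rewrite Pp; clear -Gub e1; lra.
have adms c : `|r m * y + yj m j - c| <= S3 -> xl m <= y + h * (r m * y + yj m j - c).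
  rewrite ler_norml => /andP[q _].
  have : h * - S3 <= h * (r m * y + yj m j - c) by rewrite ler_wpM2l ?(ltW h0).
  by clear -hS3 ysg; lra.
have pd : d / 2 <= p.
  rewrite leNgt; apply/negP => pd.
  pose c2 := S + 1 + W'.
  have c2S : `|r m * y + yj m j - c2| <= S3.
    by rewrite ler_norml /S3 /c2; clear -ryS S0 W'0 c00; lra.
  have := G c2 ltac:(rewrite /c2; clear -S0 W'0; lra) c2S (adms _ c2S).
  have := dcu c2.
  have := @cu_ge _ m c2 g1 ltac:(rewrite /c2; clear -S0 W'0; lra); rewrite -/u1.
  have : W' * (d / 2) <= - (r m * y + yj m j - c2) * - (p - d).
    by rewrite ler_pM // ?divr_ge0 ?(ltW d0) //; rewrite /c2; clear -ryS pd; lra.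
  have -> : W' * (d / 2) = C + 2 - u1 by rewrite /W'; field; rewrite gt_eqF.
  by clear -Gub e1; lra.
have t0 : 0 < t.
  rewrite ltNge; apply/negP => t0; move: pd; rewrite /p (max_idPl t0) mulr0.
  by clear -d0; lra.
have pE : p = k * t by rewrite /p (max_idPr (ltW t0)).
have tE : x + (sg - y) = t by rewrite /t; ring.
have [c c_gt0 subc] : exists2 c, 0 < c & rho m * v j x - eta <= cu m c
    + (r m * x + yj m j - c) * p + lamj m j * (v (other j) x - v j x).
  have := @touch_sub R m v j k (sg - y) x eta sub k0 xx.
  rewrite tE -pE; apply=> //; first exact: ltW.
  move=> x' xx'; have := M j i x' xx'; rewrite /f -/y.
  have -> : x' + sg - y = x' + (sg - y) by ring.
  by rewrite -/t; clear; lra.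
(* The slope is at least [d / 2], so a near-optimal consumption for [v] is bounded independently of
   [h]; it is then admissible in the scheme as well. *)
have cS : c <= S + 2 * (C + 1) / d.
  have rv : - (rho m * B) <= rho m * v j x.
    by rewrite -mulrN ler_pM2l //; have := vb j x; clear => /andP[].
  have Sp : (r m * x + yj m j) * p <= S * p by rewrite ler_wpM2r //; clear -rxS; lra.
  have cp : (c - S) * p <= C + 1.
    move: Lvb; rewrite ler_norml => /andP[_ q].
    by have := cu_le0 c g1; rewrite /C; clear -subc rv Sp q e1; lra.
  rewrite -lerBlDl ler_pdivlMr //.
  have [cS|cS] := leP 0 (c - S).
    by have : (c - S) * (d / 2) <= (c - S) * p; [rewrite ler_wpM2l|clear -cp; lra].
  apply: (le_trans (y := 0)); last by clear -C0; lra.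
  by rewrite nmulr_rle0 // ltW.
have sS3 : `|r m * y + yj m j - c| <= S3.
  have : 2 * (C + 1) / d <= W'.
    by rewrite /W' ler_pM2r ?invr_gt0 //; clear -u10; lra.
  by rewrite ler_norml /S3; clear -ryS S0 W'0 c00 c_gt0 cS; lra.
have Gc := G c c_gt0 sS3 (adms _ sS3).
have gs : d * (cu m c + (r m * y + yj m j - c)) <= d * (rho m * (gshift m + y)).
  by rewrite ler_wpM2l ?(ltW d0) //; exact: gshift_super.
have vo : lamj m j * (v (other j) x - v j x) <= (1 - d) * LV.
  rewrite /LV mulrCA; apply: ler_wpM2l => //.
  by have := M (other j) i x xx; rewrite /f -/y; clear; lra.
have tw : t <= w.
  have : k * t ^+ 2 <= k * w ^+ 2.
    by apply: le_trans kw; move: pent; rewrite pen_pos ?(ltW t0) //; clear; lra.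
  by rewrite ler_pM2l // ler_pXn2r // nnegrE ltW.
(* Moving [x] left to [y - sg], or to the boundary if that comes first, leaves a penalty at most
   [pen k sg]; continuity of [v] then bounds [pen k t], which is [t * p / 2]. *)
have tp : t * p <= 4 * eta.
  pose x' := Num.max (xl m) (y - sg).
  have [x1 x2] : xl m <= x' /\ y - sg <= x' by rewrite /x' !le_max !lexx orbT.
  have x3 : x' <= x by rewrite /x' ge_max xx /=; move: t0; rewrite /t; clear; lra.
  have x4 : x' <= y by rewrite /x' ge_max xg /=; clear -sg0; lra.
  have := W j x x' ltac:(by rewrite xx) ltac:(rewrite ler0_norm;
    move: tw; rewrite /t; clear -x2 x3; lra).
  rewrite ler_norml => /andP[W'' _].
  have : pen k (x' + sg - y) <= eta.
    apply: le_trans pensg; rewrite !pen_pos ?(ltW sg0) //; last by clear -x2; lra.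
    rewrite ler_wpM2l ?divr_ge0 ?(ltW k0) // ler_pXn2r //;
      rewrite ?nnegrE; clear -x2 x4 sg0; lra.
  have := M j i x' x1; rewrite /f -/y -/t (pen_pos k (ltW t0)) pE.
  by clear -W''; lra.
(* The slope of order [1] at scale [sg] gives [sg * p = 4 * P * t], and [w] was chosen with
   [4 * P * w <= eta]. *)
have sp : sg * p <= eta.
  have -> : sg * p = (k * sg) * t by rewrite pE; ring.
  rewrite ksg; apply: le_trans wP; rewrite ler_wpM2l //.
  by rewrite mulr_ge0 // ltW.
have xyp : (x - y) * r m * p <= `|r m| * (5 * eta).
  apply: (le_trans (ler_norm _)); rewrite -mulrA normrM mulrC normrM -mulrA.
  rewrite ler_wpM2l // (ger0_norm p0).
  apply: (le_trans (y := p * (t + sg))); last by clear -tp sp; lra.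
  rewrite ler_wpM2l // ler_norml; move: t0; rewrite /t; clear -sg0; lra.
have step : rho m * (v j x - (1 - d) * V j i - d * (gshift m + y))
    <= (5 * `|r m| + 3) * eta.
  have LV3 : - (eta / 4) <= (1 - d) * (rho m * h * LV) <= eta / 4.
    by move: (rho m * h * LV) LV2 => X; clear -d0 d1 e0; nra.
  by clear -subc Gc gs vo xyp LV3 e0; lra.
move=> j' i'; have := M j' i' (grid m dx i') (grid_ge m i' dx0).
rewrite /f -/y; have -> : grid m dx i' + sg - grid m dx i' = sg by ring.
have {}step : v j x - (1 - d) * V j i - d * (gshift m + y)
    <= (5 * `|r m| + 3) / rho m * eta.
  by rewrite mulrAC ler_pdivlMr // mulrC.
have := pen_ge0 (x + sg - y) (ltW k0).
by clear -step pensg; lra.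
Qed.

(** * From the two one-sided bounds to locally uniform convergence *)

(** Constant extension to the left of [xl m]: it makes [v] continuous and bounded on the whole line
    without affecting the viscosity inequalities, which only look at points of the domain. *)
Definition clamp (R : realType) (m : model R) (v : idx -> R -> R) : idx -> R -> R :=
  fun j x => v j (Num.max (xl m) x).

Lemma clampE (R : realType) (m : model R) (v : idx -> R -> R) (j : idx) (x : R) :
  xl m <= x -> clamp m v j x = v j x.
Proof. by move=> xx; rewrite /clamp (max_idPr xx). Qed.

Lemma clamp_supersol (R : realType) (m : model R) (v : idx -> R -> R) :
  viscosity_supersol m v `]xl m, +oo[%classic ->
  viscosity_supersol m (clamp m v) `]xl m, +oo[%classic.
Proof.
move=> sup phi j x0 sphi Sx0 [e e0 H].
have xx0 : xl m <= x0 by move: Sx0; rewrite /= in_itv /= andbT => /ltW.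
rewrite !clampE //; apply: sup => //; exists e => // x xx xe.
by have := H x xx xe; rewrite !clampE.
Qed.

Lemma clamp_subsol (R : realType) (m : model R) (v : idx -> R -> R) :
  viscosity_subsol m v `[xl m, +oo[%classic ->
  viscosity_subsol m (clamp m v) `[xl m, +oo[%classic.
Proof.
move=> sub phi j x0 sphi Sx0 [e e0 H].
have xx0 : xl m <= x0 by move: Sx0; rewrite /= in_itv /= andbT.
rewrite !clampE //; apply: sub => //; exists e => // x xx xe.
by have := H x xx xe; rewrite !clampE.
Qed.

Theorem mainTheorem16 (R : realType) (m : model R) (v : idx -> R -> R) :
  admissible m -> bounded_sol m v -> constrained_sol m v ->
  forall a b : R, 0 < a -> a <= b ->
  forall M eps : R, 0 < eps ->
  exists2 delta : R, 0 < delta &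
    forall (h dx : R) (V : idx -> nat -> R),
      0 < h -> 0 < dx -> rho m * h < 1 -> lam1 m * h < 1 -> lam2 m * h < 1 ->
      a <= h / dx <= b -> h < delta ->
      bounded_grid V -> scheme_sol m h dx V ->
      forall (j : idx) (x : R), xl m <= x <= M ->
        `|interp m dx (V j) x - v j x| <= eps.
Proof.
move=> adm [K HK] [cv /clamp_supersol sup /clamp_subsol sub] a b a0 _ M eps eps0.
have [rho0 [_ [_ [_ [g1 _]]]]] := adm.
have cvc j : continuous (clamp m v j) := continuous_clamp (cv j).
pose lb := cu m (rho m * xl m + y1 m) / rho m.
(* One bound for both [v] and every scheme solution, as [scheme_lower] and [scheme_upper] require it
   before [h] is chosen. *)
pose B := `|K| + `|lb|.
have B0 : 0 <= B by rewrite addr_ge0.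
have vB j x : `|clamp m v j x| <= B.
  have xm : xl m <= Num.max (xl m) x by rewrite le_max lexx.
  apply: le_trans (HK j _ xm) _; rewrite (le_trans (ler_norm _)) //.
  by rewrite lerDl.
pose G := `|gshift m + (M + 1)|.
have G0 : 0 <= G by exact: normr_ge0.
pose CA := (6 * `|r m| + 2) / rho m + 5; pose CB := (5 * `|r m| + 3) / rho m + 1.
have CA0 : 0 < CA.
  by rewrite ltr_wpDl // divr_ge0 ?(ltW rho0) // addr_ge0 ?mulr_ge0.
have CB0 : 0 < CB.
  by rewrite ltr_wpDl // divr_ge0 ?(ltW rho0) // addr_ge0 ?mulr_ge0.
have BG0 : 0 < 4 * (B + G + 1) by rewrite mulr_gt0 // ltr_wpDl // addr_ge0.
(* The cost of the convex combination and the [eta] terms get [eps / 4] each; the remaining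
   [eps / 2] goes to the modulus of continuity of [v]. *)
pose d := Num.min (1 / 2) (eps / (4 * (B + G + 1))).
pose eta := Num.min (1 / 2) (eps / (4 * (CA + CB))).
have CAB0 : 0 < 4 * (CA + CB) by rewrite mulr_gt0 // addr_gt0.
have d0 : 0 < d by rewrite lt_min; apply/andP; split; apply: divr_gt0.
have e0 : 0 < eta by rewrite lt_min; apply/andP; split; apply: divr_gt0.
have d01 : 0 < d < 1.
  by rewrite d0 gt_min; apply/orP; left; clear; lra.
have e01 : 0 < eta < 1.
  by rewrite e0 gt_min; apply/orP; left; clear; lra.
have dBG : d * (B + G) <= eps / 4.
  have : d * (4 * (B + G + 1)) <= eps by rewrite -ler_pdivlMr // /d ge_min lexx orbT.
  by clear -d0; lra.
have eC : (CA + CB) * eta <= eps / 4.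
  have : eta * (4 * (CA + CB)) <= eps by rewrite -ler_pdivlMr // /eta ge_min lexx orbT.
  by clear; lra.
have [hA hA0 HA] := scheme_upper adm cvc vB sup a0 d01 e01.
have [hB hB0 HB] := scheme_lower adm cvc vB sub a0 d01 e01.
have eps20 : 0 < eps / 2 by rewrite divr_gt0.
have [w1 w10 W1] := unif_continuous_segment (xl m) M (cvc J1) eps20.
have [w2 w20 W2] := unif_continuous_segment (xl m) M (cvc J2) eps20.
pose w := Num.min (Num.min w1 w2) 1.
have w0 : 0 < w by rewrite !lt_min w10 w20 ltr01.
have W j x z : xl m <= x <= M -> `|z - x| <= w ->
    `|clamp m v j z - clamp m v j x| <= eps / 2.
  by move=> xL xz; case: j; [apply: W1|apply: W2] => //;
    rewrite (le_trans xz) // !ge_min lexx ?orbT.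
have r10 : 0 < `|r m| + 1 by rewrite ltr_wpDl.
(* The bound [a * w] gives [dx <= w], and the last one gives [0 <= 1 + h * r m], needed for
   [scheme_lb]. *)
exists (Num.min (Num.min hA hB) (Num.min (a * w) (`|r m| + 1)^-1)).
  by rewrite !lt_min hA0 hB0 mulr_gt0 // invr_gt0.
move=> h dx V h0 dx0 rh l1h l2h /andP[ahd _]; rewrite !lt_min.
move=> /andP[/andP[hhA hhB] /andP[haw hr]] bV HV j x xM.
have dxa : dx * a <= h by rewrite mulrC -ler_pdivlMr.
have dxw : dx <= w.
  by rewrite -(ler_pM2l a0) mulrC (le_trans dxa) // ltW.
have w1' : w <= 1 by rewrite !ge_min lexx orbT.
have hr1 : 0 <= 1 + h * r m.
  have hr' : h * (`|r m| + 1) < 1 by rewrite -ltr_pdivlMr ?div1r.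
  have : h * - r m <= h * `|r m| by rewrite ler_wpM2l ?(ltW h0) // -normrN ler_norm.
  by clear -hr' h0; lra.
have VB j' i : `|V j' i| <= B.
  have V1 := scheme_le0 adm h0 dx0 rh l1h l2h bV HV j' i.
  have V2 := scheme_lb adm h0 dx0 rh l1h l2h hr1 bV HV j' i.
  rewrite ler_norml (le_trans V1 B0) andbT (le_trans _ V2) // -/lb lerNl.
  by rewrite (le_trans (ler_norm _)) // normrN lerDr.
have VA := HA h dx V h0 dx0 rh l1h l2h dxa hhA VB HV j.
have VL := HB h dx V h0 dx0 rh l1h l2h dxa hhB VB HV j.
(* It suffices to treat the two nodes around [x], as the interpolant is a convex combination of
   their values; they lie below [M + 1] because [w <= 1], which explains [G]. *)
have near i : `|grid m dx i - x| <= dx -> `|V j i - clamp m v j x| <= eps.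
  move=> ix; have xw := W j x _ xM (le_trans ix dxw).
  have gG : gshift m + grid m dx i <= G.
    rewrite (le_trans _ (ler_norm _)) // lerD2l.
    by move: ix; rewrite ler_norml => /andP[_]; clear -xM dxw w1'; lra.
  have dG : d * (gshift m + grid m dx i) <= d * G by rewrite ler_wpM2l // ltW.
  have vb := vB j (grid m dx i); have Vb := VB j i.
  rewrite ler_norml in vb; rewrite ler_norml in Vb; rewrite ler_norml in xw.
  have dv : d * - clamp m v j (grid m dx i) <= d * B.
    by rewrite ler_wpM2l ?(ltW d0) //; clear -vb; lra.
  have dV : d * - V j i <= d * B by rewrite ler_wpM2l ?(ltW d0) //; clear -Vb; lra.
  have CAe : 0 <= CA * eta by rewrite mulr_ge0 // ltW.
  have CBe : 0 <= CB * eta by rewrite mulr_ge0 // ltW.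
  have up := VA i; have lo := VL i; rewrite -/CA in up; rewrite -/CB in lo.
  rewrite ler_norml; clear -up lo dG dv dV xw dBG eC CAe CBe.
  by apply/andP; split; lra.
have /andP[xx _] := xM; rewrite -(clampE v j xx).
have [n [th [/andP[th0 th1] xE ->]]] := interpE dx0 xx.
have n1 : `|grid m dx n - x| <= dx.
  rewrite xE distrC addrAC subrr add0r ger0_norm ?mulr_ge0 ?(ltW dx0) //.
  by rewrite ler_piMl // ltW.
have n2 : `|grid m dx n.+1 - x| <= dx.
  have -> : grid m dx n.+1 - x = (1 - th) * dx by rewrite xE /grid -natr1; ring.
  by rewrite ger0_norm ?mulr_ge0 ?subr_ge0 ?(ltW dx0) // ler_piMl ?(ltW dx0) // gerBl.
have := near n n1; have := near n.+1 n2; rewrite !ler_norml.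
by clear -th0 th1 => /andP[p q] /andP[p' q']; apply/andP; split; nra.
Qed.
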